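(* Let $\alpha\in(0,1)$, $\lambda>-1/2$, and let $f:[0,1]\to\mathbb R$ satisfy $f\in C^{n+1}([0,1])$ for every $n$ considered. Put $\mathcal A_m=\|f^{(m)}\|_{L^\infty([0,1])}$. Suppose $f$ is approximated by its interpolant $I_nf$ at the $n+1$ shifted Gegenbauer-Gauss points with index $\lambda$ and that the integrals $\int_0^1\hat G_j^{\lambda}\big(t(1-y^{1/\alpha})\big)\,dy$, $j=0,\dots,n$, are computed exactly for any $t\in[0,1]$. Then there is a constant $\sigma_\lambda>1$ depending on $\lambda$ such that the truncation error ${}^{\alpha}\mathcal T_n^{\lambda}(t,\xi)=\mathfrak I_t^{\alpha}f-\mathfrak I_t^{\alpha}(I_nf)$, $t\in[0,1]$, satisfies, for all sufficiently large $n$, the asymptotic bound $$\left|{}^{\alpha}\mathcal T_n^{\lambda}(t,\xi)\right|\ \lesssim\ \mathcal A_{n+1}\,\vartheta_{\alpha,\lambda}\left(\frac e4\right)^n n^{-\frac32-n+\lambda}\,\Upsilon_{\sigma_\lambda}(n),$$ where $$\Upsilon_{\sigma_\lambda}(n)=\begin{cases}1,&\lambda\ge0,\\ \sigma_\lambda n^{-\lambda},&-\tfrac12<\lambda<0,\end{cases}$$ and $$\vartheta_{\alpha,\lambda}=\frac1{4\pi}e^{\alpha+1}\alpha^{-\frac12-\alpha}(1+2\lambda)^{-\frac12-2\lambda}\left[1+\frac1{1620(1+\lambda)^5}\right]\left[\frac{(1+\lambda)\operatorname{csch}\left(\frac1{1+2\lambda}\right)}{1+2\lambda}\right]^{\f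rac12+\lambda}\left[\alpha\sinh\left(\tfrac1\alpha\right)\right]^{-\alpha/2}\left[(1+\lambda)\sinh\left(\tfrac1{1+\lambda}\right)\right]^{\frac{1+\lambda}2}.$$
   Context: The left Riemann-Liouville fractional integral of order $\alpha\in(0,1)$ is $\mathfrak I_t^{\alpha}f=\frac1{\Gamma(\alpha)}\int_0^t(t-\tau)^{\alpha-1}f(\tau)\,d\tau$. For $\lambda>-1/2$ the Gegenbauer polynomials $G_n^{\lambda}$ on $[-1,1]$ are orthogonal with respect to the weight $(1-x^2)^{\lambda-1/2}$ and normalized by $G_0^{\lambda}(x)=1$, $G_1^{\lambda}(x)=x$, $(n+2\lambda)G_{n+1}^{\lambda}(x)=2(n+\lambda)xG_n^{\lambda}(x)-nG_{n-1}^{\lambda}(x)$ for $n\ge1$ (so $G_n^\lambda(1)=1$). The shifted Gegenbauer (SG) polynomials on $[0,1]$ are $\hat G_n^{\lambda}(t)=G_n^{\lambda}(2t-1)$. The shifted Gegenbauer-Gauss points with index $\lambda$ are the $n+1$ zeros in $(0,1)$ of $\hat G_{n+1}^{\lambda}$, and $I_nf$ is the polynomial of degree at most $n$ that interpolates $f$ at these points. The symbol $\xi=\xi(t)\in(0,1)$ in ${}^{\alpha}\mathcal T_n^{\lambda}(t,\xi)$ is a point at which the truncation error is represented as ${}^{\alpha}\mathcal T_n^{\lambda}(t,\xi)=\frac{t^{\alpha}f^{(n+1)}(\xi)}{(n+1)!\,\Gamma(\alpha+1)\,\hat K_{n+1}^{\lambda}}\int_0^1\hat G_{n+1}^{\lambda}(t(1-y^{1/\alpha}))\,dy$,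 with $\hat K_{n+1}^\lambda$ the leading coefficient of $\hat G_{n+1}^\lambda$. Notation: $a_n\lesssim b_n$ (''asymptotically less than'') means $a_n\le(1+o(1))\,b_n$ as $n\to\infty$. *)

(* Defs.v *)
From HB Require Import structures.
From mathcomp Require Import all_boot all_order all_algebra.
From mathcomp Require Import all_classical all_reals all_analysis.
Import Order.TTheory GRing.Theory Num.Theory.
Import numFieldNormedType.Exports.

Set Implicit Arguments.
Unset Strict Implicit.
Unset Printing Implicit Defensive.

Local Open Scope classical_set_scope.
Local Open Scope ring_scope.

Definition sinh {R : realType} (x : R) : R := (expR x - expR (- x)) / 2.

Definition csch {R : realType} (x : R) : R := (sinh x)^-1.

Definition Gamma {R : realType} (a : R) : R :=
  \int[lebesgue_measure]_(x in `]0, +oo[) (x `^ (a - 1) * expR (- x)).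

(* Left Riemann-Liouville fractional integral.  The singularity at the right
   endpoint is a Lebesgue-null point. *)
Definition RL_integral {R : realType} (alpha : R) (f : R -> R) (t : R) : R :=
  (Gamma alpha)^-1 *
  \int[lebesgue_measure]_(x in `[0, t]) ((t - x) `^ (alpha - 1) * f x).

(* Normalized so that the value at 1 is 1:
   (m + 2 lam) G_(m+1) = 2 (m + lam) X G_m - m G_(m-1) for m >= 1. *)
Fixpoint gegenbauer {R : realType} (lam : R) (n : nat) : {poly R} :=
  match n with
  | 0 => 1
  | n'.+1 =>
    match n' with
    | 0 => 'X
    | k.+1 => let m : R := k.+1%:R in
      (m + 2 * lam)^-1 *:
        ((2 * (m + lam)) *: ('X * gegenbauer lam n') - m *: gegenbauer lam k)
    end
  end.

Definition shifted_gegenbauer {R : realType} (lam : R) (n : nat) : {poly R} :=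
  gegenbauer lam n \Po (2 *: 'X - 1).

Definition SGG_points {R : realType} (lam : R) (n : nat) : set R :=
  [set x | 0 < x < 1 /\ root (shifted_gegenbauer lam n.+1) x].

(* Degree at most n is size at most n + 1; the default value 0 would only be
   returned if no interpolant existed. *)
Definition SGG_interpolant {R : realType} (lam : R) (n : nat) (f : R -> R)
    : {poly R} :=
  xget 0 [set p : {poly R} | (size p <= n.+1)%N /\
                             (forall x, SGG_points lam n x -> p.[x] = f x)].

Definition truncation_error {R : realType} (alpha lam : R) (n : nat)
    (f : R -> R) (t : R) : R :=
  RL_integral alpha f t
  - RL_integral alpha (fun x => (SGG_interpolant lam n f).[x]) t.

(* C^m([0,1]): the derivatives of order at most m exist on the open interval
   and extend continuously to the closed one, the extension of f itself being
   f.  Two-sided derivatives are taken at interior points only, so that values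
   of f outside [0,1] are irrelevant. *)
Definition C01 {R : realType} (m : nat) (f : R -> R) : Prop :=
  [/\ {within `[0, 1], continuous f},
      (forall k x, (k < m)%N -> 0 < x < 1 -> derivable (derive1n k f) x 1) &
      (forall k, (k <= m)%N -> exists2 g : R -> R,
         {within `[0, 1], continuous g} &
         forall x, 0 < x < 1 -> derive1n k f x = g x)].

(* The L^oo([0,1]) norm of the m-th derivative.  The values of derive1n at the
   endpoints do not matter, the norm being an essential supremum; it is finite
   when f is C^m([0,1]). *)
Definition deriv_norm {R : realType} (m : nat) (f : R -> R) : R :=
  fine ('N[lebesgue_measure]_(+oo%E) [EFin \o (derive1n m f \_ `[0, 1])]).

(* a_n(t) <= (1 + o(1)) b_n for all large n, uniformly in t in D. *)
Definition asymp_le_on {R : realType} (D : set R) (a : nat -> R -> R)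
    (b : nat -> R) : Prop :=
  exists eps : nat -> R, (eps n @[n --> \oo] --> (0 : R)) /\
    \forall n \near \oo, forall t, D t -> a n t <= (1 + eps n) * b n.

Definition Upsilon {R : realType} (lam sigma : R) (n : nat) : R :=
  if 0 <= lam then 1 else sigma * n%:R `^ (- lam).

Definition vartheta {R : realType} (alpha lam : R) : R :=
  1 / (4 * pi) * expR (alpha + 1) * alpha `^ (- (1 / 2) - alpha)
  * (1 + 2 * lam) `^ (- (1 / 2) - 2 * lam)
  * (1 + 1 / (1620 * (1 + lam) ^+ 5))
  * ((1 + lam) * csch (1 / (1 + 2 * lam)) / (1 + 2 * lam)) `^ (1 / 2 + lam)
  * (alpha * sinh (1 / alpha)) `^ (- (alpha / 2))
  * ((1 + lam) * sinh (1 / (1 + lam))) `^ ((1 + lam) / 2).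

(* Main.v *)
Require Import Defs.
From HB Require Import structures.
From mathcomp Require Import all_boot all_order all_algebra.
From mathcomp Require Import all_classical all_reals all_analysis.
From mathcomp Require Import measurable_realfun ess_sup_inf.
From mathcomp Require polyrcf.
From mathcomp Require Import ring lra zify.
Import Order.TTheory GRing.Theory Num.Theory.
Import numFieldNormedType.Exports.

Set Implicit Arguments.
Unset Strict Implicit.
Unset Printing Implicit Defensive.

Local Open Scope classical_set_scope.
Local Open Scope ring_scope.

(** Write [G n] for the Gegenbauer polynomials of index [lam], [SG n] for the
    shifted ones and [A m] for the norm of the derivative of order [m] of [f].
    At each point of [(0, 1)] Cauchy's remainder formula bounds the
    interpolation error by [A (n + 1) / (n + 1)!] times the monic node
    polynomial, which is [SG (n + 1) / (2 * 4 ^ n * P n)] with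
    [P n = prod_(1 <= m <= n) (m + lam) / (m + 2 lam)]
    ([interpolation_error_le]).  Integrating against the kernel,
      [|T| <= A (n + 1) / (Gamma alpha * (n + 1)! * 2 * 4 ^ n * P n) * J n],
      [J n = int_0^t (t - x) ^ (alpha - 1) |SG (n + 1) (x)| dx].
    A one-sided Stirling estimate for the factorial ([fact_ge_Stirling]) brings
    out [(e / 4) ^ n * n ^ (- 3 / 2 - n)], and [P n >= exp (- |lam|) n ^ (- lam)]
    ([lead_ratio_ge]) gives the factor [n ^ lam].  It remains to compare [J n]
    with the constant [vartheta], and this depends on the sign of [lam].

    For [lam > 0], bounding [|SG (n + 1)|] by its maximum [1] is not enough: the
    constant so obtained behaves like [exp (alpha + lam)] where [vartheta] has
    [exp (alpha + 1)], and exceeds [vartheta] for large [lam].  But [SG n] tends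
    to [0] at every interior point, so that [J n] tends to [0] uniformly in [t]
    and any positive constant will do.  The decay ([gegenbauer_decay]) comes from
    the quadratic form [G (n+1) ^ 2 - 2 x G (n+1) G n + G n ^ 2], which the
    recurrence decreases by a fraction of order [1 / n] every two steps, and from
    the divergence of the harmonic series; the same form gives [|G n| <= 1] for
    [lam >= 0].

    For [lam = 0] the polynomials are Chebyshev's, [J n <= 1 / alpha], and the
    constants have to be compared: up to the Windschitl approximation of
    [Gamma (alpha + 1)], [vartheta] is about [e] times the constant needed, so crude
    numerical bounds for [pi], [e] and [Gamma] suffice
    ([vartheta_alpha_Gamma_ge], [scalar_bound_0]).

    For [lam < 0] the maximum of [|G n|] grows like [n ^ (- lam)], which is the
    factor [Upsilon]: by Gegenbauer's differential equation Sonine's function is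
    largest at the origin ([gegenbauer_sqr_le_at0]), where the recurrence
    is solved by a product.  Constants are absorbed by [sigma], uniformly in
    [alpha] because [alpha * Gamma alpha * vartheta] is bounded below on
    [(0, 1)] by the estimate already used for [lam = 0].

    That there are [n + 1] nodes in [(0, 1)] is the classical interlacing
    argument ([gegenbauer_roots]). *)

(** * Recurrence, derivatives and leading coefficient of Gegenbauer polynomials *)

Section GegenbauerAlgebra.
Variables (R : realType) (lam : R).
Hypothesis hlam : - (1 / 2) < lam.
Local Notation G := (gegenbauer lam).

Lemma gegenbauer_den_gt0 (n : nat) : 0 < n.+1%:R + 2 * lam.
Proof. have : (0 : R) <= n%:R by []. rewrite -natr1; move: hlam; lra. Qed.

Lemma gegenbauerSS (n : nat) : G n.+2 = (n.+1%:R + 2 * lam)^-1 *: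
  ((2 * (n.+1%:R + lam)) *: ('X * G n.+1) - n.+1%:R *: G n).
Proof. by []. Qed.

Lemma gegenbauer_rec (n : nat) (x : R) :
  (n.+1%:R + 2 * lam) * (G n.+2).[x]
  = 2 * (n.+1%:R + lam) * x * (G n.+1).[x] - n.+1%:R * (G n).[x].
Proof.
have D := lt0r_neq0 (gegenbauer_den_gt0 n).
rewrite gegenbauerSS !(hornerD, hornerN, hornerZ, hornerM, hornerX, hornerC).
by rewrite mulVKf //; ring.
Qed.

Lemma gegenbauer_deriv_rec (n : nat) (x : R) :
  (n.+1%:R + 2 * lam) * (G n.+2)^`().[x]
  = 2 * (n.+1%:R + lam) * ((G n.+1).[x] + x * (G n.+1)^`().[x])
    - n.+1%:R * (G n)^`().[x].
Proof.
have D := lt0r_neq0 (gegenbauer_den_gt0 n).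
rewrite gegenbauerSS !(derivZ, derivB, derivM, derivX).
rewrite !(hornerD, hornerN, hornerZ, hornerM, hornerX, hornerC).
by rewrite mulVKf //; ring.
Qed.

(** The two structure relations express [(1 - x ^ 2) G'] through a neighbour of
    lower, respectively higher, degree.  The recurrence exchanges them, so that
    differentiating it proves the first one by induction. *)
Lemma gegenbauer_deriv_up_of_down (n : nat) (x : R) :
  (1 - x ^+ 2) * (G n.+1)^`().[x] = n.+1%:R * ((G n).[x] - x * (G n.+1).[x]) ->
  (1 - x ^+ 2) * (G n.+1)^`().[x]
  = (n.+1%:R + 2 * lam) * (x * (G n.+1).[x] - (G n.+2).[x]).
Proof. by move=> ->; have := gegenbauer_rec n x; lra. Qed.

Lemma gegenbauer_deriv_down (n : nat) (x : R) :
  (1 - x ^+ 2) * (G n.+1)^`().[x] = n.+1%:R * ((G n).[x] - x * (G n.+1).[x]).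
Proof.
elim/ltn_ind: n => -[|n] IH.
  by rewrite /= derivX !hornerE; ring.
have H1 := gegenbauer_rec n x; have H2 := gegenbauer_deriv_rec n x.
have I1 := IH n (ltnSn n).
have I0 : (1 - x ^+ 2) * (G n)^`().[x]
    = (n%:R + 2 * lam) * (x * (G n).[x] - (G n.+1).[x]).
  case: n IH {I1} H1 H2 => [|n] IH H1 H2; first by rewrite /= derivC !hornerE; ring.
  by apply: gegenbauer_deriv_up_of_down; apply: IH.
apply: (mulfI (lt0r_neq0 (gegenbauer_den_gt0 n))).
rewrite mulrCA H2.
transitivity (n.+2%:R * ((n.+1%:R + 2 * lam) * (G n.+1).[x]
    - x * ((n.+1%:R + 2 * lam) * (G n.+2).[x]))); last by ring.
rewrite H1 mulrBr !mulrDr.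
move: I0 I1; rewrite -[n.+2%:R]natr1 -[n.+1%:R]natr1.
set a := (G n).[x]; set b := (G n.+1).[x].
set a' := (G n)^`().[x]; set b' := (G n.+1)^`().[x].
set N := n%:R; move=> I0 I1.
transitivity (2 * (N + 1 + lam) * (1 - x^+2) * b
  + 2 * (N + 1 + lam) * x * ((1 - x^+2) * b')
  - (N + 1) * ((1 - x^+2) * a')); first by ring.
by rewrite I0 I1; ring.
Qed.

Lemma gegenbauer_deriv_up (n : nat) (x : R) :
  (1 - x ^+ 2) * (G n)^`().[x] = (n%:R + 2 * lam) * (x * (G n).[x] - (G n.+1).[x]).
Proof.
case: n => [|n]; first by rewrite /= derivC !hornerE; ring.
exact/gegenbauer_deriv_up_of_down/gegenbauer_deriv_down.
Qed.

Lemma gegenbauer1 (n : nat) : (G n).[1] = 1.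
Proof.
elim/ltn_ind: n => -[|[|n]] IH; [by rewrite hornerE|by rewrite hornerE|].
apply: (mulfI (lt0r_neq0 (gegenbauer_den_gt0 n))).
by rewrite gegenbauer_rec !IH //; ring.
Qed.

Lemma gegenbauerN1 (n : nat) : (G n).[-1] = (-1) ^+ n.
Proof.
elim/ltn_ind: n => -[|[|n]] IH; [by rewrite hornerE|by rewrite hornerE|].
apply: (mulfI (lt0r_neq0 (gegenbauer_den_gt0 n))).
by rewrite gegenbauer_rec !IH // !exprS; ring.
Qed.

(** The leading coefficient of the polynomial of degree [n + 1], divided by
    [2 ^ n]. *)
Definition lead_ratio (n : nat) : R :=
  \prod_(m < n) ((m.+1%:R + lam) / (m.+1%:R + 2 * lam)).

Lemma lead_ratio_gt0 (n : nat) : 0 < lead_ratio n.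
Proof.
apply: prodr_gt0 => m _; apply: divr_gt0; last exact: gegenbauer_den_gt0.
have : (0 : R) <= m%:R by []. rewrite -natr1; move: hlam; lra.
Qed.

Lemma size_gegenbauer_coef (n : nat) :
  (size (G n.+1) <= n.+2)%N /\ (G n.+1)`_n.+1 = 2 ^+ n * lead_ratio n.
Proof.
elim/ltn_ind: n => -[|n] IH.
  by rewrite /= size_polyX coefX /lead_ratio big_ord0 mulr1.
have [s1 c1] := IH n (ltnSn n).
have s0 : (size (G n) <= n.+1)%N.
  by case: n IH {s1 c1} => [|n] IH; rewrite ?size_polyC ?oner_neq0 //; case: (IH n).
split.
  apply: leq_trans (size_scale_leq _ _) _.
  apply: leq_trans (size_polyD _ _) _; rewrite size_polyN geq_max; apply/andP; split.
    apply: leq_trans (size_scale_leq _ _) _.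
    by rewrite (leq_trans (size_mul_leq _ _)) // size_polyX.
  by apply: leq_trans (size_scale_leq _ _) _; apply: leq_trans s0 _; lia.
rewrite gegenbauerSS !(coefZ, coefB) coefXM /= c1.
rewrite (nth_default _ (leq_trans s0 _)) //.
rewrite /lead_ratio big_ord_recr /=.
have := lt0r_neq0 (gegenbauer_den_gt0 n) => D.
by rewrite exprS; field; rewrite nat1r.
Qed.

Lemma lead_coef_gegenbauer (n : nat) :
  size (G n.+1) = n.+2 /\ lead_coef (G n.+1) = 2 ^+ n * lead_ratio n.
Proof.
have [size_le coefE] := size_gegenbauer_coef n.
have c_gt0 : 0 < (G n.+1)`_n.+1.
  by rewrite coefE mulr_gt0 ?exprn_gt0 ?lead_ratio_gt0.
have size_eq : size (G n.+1) = n.+2.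
  apply/eqP; rewrite eqn_leq size_le ltnNge; apply/negP => h.
  by move: c_gt0; rewrite nth_default ?ltxx.
by rewrite lead_coefE size_eq.
Qed.

End GegenbauerAlgebra.

(** * Interlacing zeros *)

Section SimpleRealRoots.
Variable R : realType.
Implicit Types (p : {poly R}) (s z : nat -> R).

(** At the root [s i] the derivative is the product of the [s i - s j], of which
    those with [j > i] are negative. *)
Lemma sign_deriv_prod_XsubC (n i : nat) s :
  (forall k l, (k < l < n)%N -> s k < s l) -> (i < n)%N ->
  0 < (-1) ^+ (n.-1 - i) * (\prod_(j < n) ('X - (s j)%:P))^`().[s i].
Proof.
move=> s_incr lt_in; pose i' := Ordinal lt_in.
rewrite (bigD1 i') //= derivM derivXsubC mul1r !hornerE.
rewrite subrr mul0r addr0 horner_prod.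
have -> : (-1) ^+ (n.-1 - i) = \prod_(j < n | j != i') (if (i < j)%N then -1 else 1) :> R.
  rewrite -big_mkcondr /=.
  transitivity (\prod_(0 <= j < n | (i < j)%N) (-1) : R).
    have -> : (n.-1 - i)%N = (n - i.+1)%N by lia.
    rewrite (big_nat_widenl _ 0) // big_nat_cond.
    rewrite (big_cat_nat (n := i.+1)) //= big1_seq ?mul1r; last first.
      by move=> j; rewrite mem_index_iota; lia.
    rewrite -prodr_const_nat big_nat_cond [RHS]big_nat_cond.
    apply: eq_bigl => j; lia.
  rewrite big_mkord; apply: eq_bigl => j.
  by case: (boolP (i < j)%N) => [ij|]; rewrite ?andbF ?andbT // -val_eqE /= gtn_eqF.
rewrite -big_split /=; apply: prodr_gt0 => j ji; rewrite !hornerE.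
have {ji} : nat_of_ord j != i by [].
rewrite neq_ltn => /orP[ji|ij].
  by rewrite ltnNge (ltnW ji) /= mul1r subr_gt0 s_incr // ji.
by rewrite ij mulN1r opprB subr_gt0 s_incr // ij /=.
Qed.

Lemma root_between p (a b : R) : a < b -> p.[a] * p.[b] < 0 ->
  exists x, a < x < b /\ root p x.
Proof.
move=> ab pab.
have [x axb px] : exists2 x, a <= x <= b & root p x.
  case: (ltP p.[a] 0) => pa.
    by apply: poly_ivt; [exact: ltW|nra].
  have [||x axb] := @poly_ivt _ (- p) a b; first exact: ltW.
    by rewrite !hornerN; nra.
  by rewrite rootN; exists x.
exists x; split => //; move/rootP: px => px; case/andP: axb => ax xb.
apply/andP; split; rewrite lt_neqAle ?ax ?xb andbT; apply/eqP => E.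
  by move: pab; rewrite E px mul0r ltxx.
by move: pab; rewrite -E px mulr0 ltxx.
Qed.

(** The intermediate value theorem provides as many roots as the degree
    allows. *)
Lemma factor_of_sign_changes p (m : nat) z :
  (size p <= m.+1)%N ->
  (forall i, (i < m)%N -> z i < z i.+1) ->
  (forall i, (i <= m)%N -> 0 < (-1) ^+ (m - i) * p.[z i]) ->
  exists2 y, forall i, (i < m)%N -> z i < y i < z i.+1
           & p = lead_coef p *: \prod_(i < m) ('X - (y i)%:P).
Proof.
move=> size_p z_incr sgn.
have ex i : exists x, (i < m)%N -> z i < x < z i.+1 /\ root p x.
  have [im|_] := ltnP i m; last by exists 0.
  have [||x xP] := @root_between p (z i) (z i.+1); last by exists x.
    exact: z_incr.
  have := mulr_gt0 (sgn _ (ltnW im)) (sgn _ im).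
  rewrite mulrACA; have -> : (m - i = (m - i.+1).+1)%N by lia.
  by rewrite exprS mulN1r mulNr -expr2 sqrr_sign mulN1r oppr_gt0.
have {ex} [y yP] := choice ex.
have y_lt i j : (i < j)%N -> (j < m)%N -> y i < y j.
  elim: j => // j IHj; rewrite ltnS leq_eqVlt => /orP[/eqP->|ij] jm.
    have [/andP[_ h1] _] := yP j (ltnW jm); have [/andP[h2 _] _] := yP _ jm.
    exact: lt_trans h1 h2.
  apply: lt_trans (IHj ij (ltnW jm)) _.
  have [/andP[_ h1] _] := yP j (ltnW jm); have [/andP[h2 _] _] := yP _ jm.
  exact: lt_trans h1 h2.
exists y; first by move=> i im; have [] := yP i im.
have y_uniq : uniq (map y (iota 0 m)).
  rewrite map_inj_in_uniq ?iota_uniq // => i j; rewrite !mem_iota !add0n => im jm yij.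
  by case: (ltngtP i j) => // ij; have := y_lt _ _ ij; rewrite yij ltxx;
    [move/(_ jm)|move/(_ im)].
have y_roots : all (root p) (map y (iota 0 m)).
  apply/allP => x /mapP[i]; rewrite mem_iota add0n => im ->.
  by have [] := yP i im.
have p_neq0 : p != 0.
  by apply/eqP => p0; have := sgn m (leqnn m); rewrite p0 horner0 mulr0 ltxx.
have size_eq : size p = m.+1.
  apply/eqP; rewrite eqn_leq size_p /=.
  by have := max_poly_roots p_neq0 y_roots y_uniq; rewrite size_map size_iota.
rewrite {1}(@all_roots_prod_XsubC _ p (map y (iota 0 m))) //; last first.
- by rewrite uniq_rootsE.
- by rewrite size_map size_iota size_eq.
by rewrite big_map -(big_mkord xpredT (fun i => 'X - (y i)%:P)) /index_iota subn0.
Qed.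

End SimpleRealRoots.

(** Interlacing: at a zero [s i] of the polynomial of degree [n] the next one
    has the sign opposite to the derivative there, so its signs at
    [-1 < s 0 < ... < s (n - 1) < 1] alternate. *)
Lemma gegenbauer_roots (R : realType) (lam : R) (n : nat) :
  - (1 / 2) < lam ->
  exists s : nat -> R,
    [/\ forall i, (i < n)%N -> -1 < s i < 1,
        forall k l, (k < l < n)%N -> s k < s l &
        gegenbauer lam n
        = lead_coef (gegenbauer lam n) *: \prod_(i < n) ('X - (s i)%:P)].
Proof.
move=> hlam; elim: n => [|n [s [s_in s_incr]]].
  by exists (fun=> 0); split => [//|k l /andP[]//|]; rewrite big_ord0 lead_coefC scale1r.
set K := lead_coef _ => GE.
have K_gt0 : 0 < K.
  rewrite /K; case: (n) => [|k]; first by rewrite lead_coefC.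
  by rewrite (lead_coef_gegenbauer hlam k).2 mulr_gt0 ?exprn_gt0 ?lead_ratio_gt0.
pose z i := if i is i'.+1 then if (i' < n)%N then s i' else 1 else -1.
have zS i : z i.+1 = if (i < n)%N then s i else 1 by [].
have [size_G _] := size_gegenbauer_coef hlam n.
have G_incr i : (i < n.+1)%N -> z i < z i.+1.
  case: i => [_|i] /=.
    by case: ifP => n0; [have /andP[] := s_in 0%N n0|lra].
  rewrite ltnS => i_n; rewrite i_n; case: ifP => i1n.
    by apply: s_incr; rewrite ltnSn.
  by have /andP[] := s_in i i_n.
have sgn i : (i <= n.+1)%N ->
    0 < (-1) ^+ (n.+1 - i) * (gegenbauer lam n.+1).[z i].
  case: i => [_|i]; first by rewrite subn0 gegenbauerN1 // -expr2 sqrr_sign.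
  rewrite ltnS subSS zS => i_le; case: ifP => i_n; last first.
    have -> : i = n by lia.
    by rewrite subnn gegenbauer1 // mul1r.
  have /andP[s1 s2] := s_in i i_n.
  have := gegenbauer_deriv_up hlam n (s i).
  have -> : (gegenbauer lam n).[s i] = 0.
    rewrite GE hornerZ horner_prod (bigD1 (Ordinal i_n)) //=.
    by rewrite hornerXsubC subrr mul0r mulr0.
  rewrite mulr0 add0r GE derivZ hornerZ => E.
  have D : 0 < n%:R + 2 * lam.
    by rewrite -(prednK (leq_ltn_trans (leq0n i) i_n)); exact: gegenbauer_den_gt0.
  have P := sign_deriv_prod_XsubC s_incr i_n.
  have S : 0 < 1 - s i ^+ 2 by nra.
  have -> : (n - i = (n.-1 - i).+1)%N by lia.
  rewrite exprS mulN1r.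
  rewrite -(pmulr_rgt0 _ D).
  have -> : (n%:R + 2 * lam) * (- (-1) ^+ (n.-1 - i) * (gegenbauer lam n.+1).[s i])
    = (-1) ^+ (n.-1 - i) * ((n%:R + 2 * lam) * - (gegenbauer lam n.+1).[s i]) by ring.
  rewrite -E.
  have := mulr_gt0 (mulr_gt0 S K_gt0) P.
  by congr (0 < _); ring.
have [y yP Gy] := factor_of_sign_changes size_G G_incr sgn.
have yz i : (i < n.+1)%N -> -1 <= z i /\ z i.+1 <= 1.
  move=> i_n; split.
    case: i i_n => // i /=; rewrite ltnS => i_n; rewrite i_n.
    by have /andP[/ltW] := s_in i i_n.
  by rewrite /=; case: ifP => // i_n'; have /andP[_ /ltW] := s_in i i_n'.
exists y; split.
- move=> i i_n; have [? ?] := yz i i_n; have /andP[? ?] := yP i i_n.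
  by apply/andP; split; lra.
- move=> i j /andP[ij j_n]; elim: j j_n ij => // j IHj j_n.
  have /andP[h2 _] := yP _ j_n.
  have /andP[_ h1] := yP j (ltnW j_n).
  rewrite ltnS leq_eqVlt => /orP[/eqP->|ij]; first exact: lt_trans h1 h2.
  exact: lt_trans (IHj (ltnW j_n) ij) (lt_trans h1 h2).
exact: Gy.
Qed.

(** * Bounds for Gegenbauer polynomials *)

Section HarmonicSums.
Variable R : realType.

Lemma powR_expR_ln (a x : R) : 0 < a -> a `^ x = expR (x * ln a).
Proof. by move=> a0; rewrite /powR gt_eqF. Qed.

Definition harmonic_sum (n : nat) : R := \sum_(k < n) k.+1%:R^-1.

Lemma ln_le_harmonic_sum (n : nat) : ln n.+1%:R <= harmonic_sum n.
Proof.
elim: n => [|n IH]; first by rewrite ln1 /harmonic_sum big_ord0.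
rewrite /harmonic_sum big_ord_recr /= -/(harmonic_sum n).
have n0 : (0 : R) < n.+1%:R by [].
have -> : n.+2%:R = n.+1%:R * (1 + n.+1%:R^-1) :> R.
  by rewrite mulrDr mulr1 divff ?lt0r_neq0 // -natr1.
have i0 : (0 : R) < n.+1%:R^-1 by rewrite invr_gt0.
rewrite lnM ?posrE ?addr_gt0 //.
by rewrite lerD // le_ln1Dx // (lt_trans _ i0).
Qed.

Lemma harmonic_sum_le_ln (n : nat) : harmonic_sum n.+1 <= 1 + ln n.+1%:R.
Proof.
elim: n => [|n IH]; first by rewrite ln1 /harmonic_sum big_ord_recr big_ord0 /= invr1; lra.
rewrite /harmonic_sum big_ord_recr /= -/(harmonic_sum n.+1).
have n0 : (0 : R) < n.+1%:R by [].
have n1 : (0 : R) < n.+2%:R by [].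
have E : n.+1%:R = n.+2%:R * (1 - n.+2%:R^-1) :> R.
  by rewrite mulrBr mulr1 divff ?lt0r_neq0 // -[n.+2%:R]natr1; ring.
have lt1 : (n.+2%:R^-1 : R) < 1 by rewrite invf_lt1 ?ltr1n.
have lnle : ln (1 - n.+2%:R^-1) <= - n.+2%:R^-1 :> R by apply: le_ln1Dx; rewrite ltrN2.
have : ln (n.+1%:R : R) = ln n.+2%:R + ln (1 - n.+2%:R^-1).
  by rewrite {1}E lnM ?posrE // subr_gt0.
by move: IH lnle; set y := _^-1; set S := harmonic_sum _; lra.
Qed.

End HarmonicSums.

Section GegenbauerBounds.
Variables (R : realType) (lam : R).
Hypothesis hlam : - (1 / 2) < lam.
Local Notation G := (gegenbauer lam).

(** Each factor is [(1 + lam / (m + lam)) ^ -1 >= exp (- lam / (m + lam))], and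
    [- lam / (m + lam) >= - lam / m] whatever the sign of [lam]. *)
Lemma lead_ratio_ge (n : nat) :
  expR (- `|lam|) * n.+1%:R `^ (- lam) <= lead_ratio lam n.+1.
Proof.
apply: (@le_trans _ _ (expR (- lam * harmonic_sum R n.+1))).
  rewrite powR_expR_ln // -expRD ler_expR.
  case: (lerP 0 lam) => l0.
    have h := ler_wpM2l l0 (harmonic_sum_le_ln R n).
    by rewrite ger0_norm //; move: h; set S := harmonic_sum _ _; set L := ln _; lra.
  have h1 := ln_le_harmonic_sum R n.+1.
  have h2 : ln (n.+1%:R : R) <= ln n.+2%:R by rewrite ler_ln ?posrE // ler_nat.
  have l1 : 0 <= - lam by rewrite oppr_ge0 ltW.
  have h := ler_wpM2l l1 (le_trans h2 h1).
  by rewrite ltr0_norm //; move: h; set S := harmonic_sum _ _; set L := ln _; lra.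
rewrite mulr_sumr expR_sum; apply: ler_prod => m _; rewrite expR_ge0 /=.
have m0 : (1 : R) <= m.+1%:R by rewrite ler1n.
have D : 0 < m.+1%:R + lam by move: hlam; lra.
have D2 := gegenbauer_den_gt0 hlam m.
apply: (@le_trans _ _ (expR (- (lam / (m.+1%:R + lam))))).
  rewrite ler_expR mulNr lerN2 ler_pdivrMr //.
  rewrite -subr_ge0; have -> : lam / m.+1%:R * (m.+1%:R + lam) - lam = lam ^+ 2 / m.+1%:R.
    by field; rewrite nat1r.
  by rewrite divr_ge0 ?sqr_ge0.
rewrite expRN -[leRHS]invf_div lef_pV2 ?posrE ?expR_gt0 ?divr_gt0 //.
have -> : (m.+1%:R + 2 * lam) / (m.+1%:R + lam) = 1 + lam / (m.+1%:R + lam).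
  by field; rewrite nat1r lt0r_neq0.
exact: expR_ge1Dx.
Qed.

(** A quadratic form in two consecutive values, definite for [`|x| < 1]; the
    recurrence multiplies one of its two squares by [r ^+ 2]. *)
Definition energy (n : nat) (x : R) : R :=
  (G n.+1).[x] ^+ 2 - 2 * x * (G n.+1).[x] * (G n).[x] + (G n).[x] ^+ 2.

Local Notation d n x := (x * (G n.+1).[x] - (G n).[x]).
Local Notation r n := (n.+1%:R / (n.+1%:R + 2 * lam)).

Lemma energyE (n : nat) (x : R) :
  energy n x = d n x ^+ 2 + (1 - x ^+ 2) * (G n.+1).[x] ^+ 2.
Proof. by rewrite /energy; ring. Qed.

Lemma gegenbauer_next (n : nat) (x : R) :
  (G n.+2).[x] = x * (G n.+1).[x] + r n * d n x.
Proof.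
have D := lt0r_neq0 (gegenbauer_den_gt0 hlam n).
apply: (mulfI D); rewrite (gegenbauer_rec hlam n x).
by field; rewrite nat1r.
Qed.

Lemma energyS (n : nat) (x : R) :
  energy n.+1 x = energy n x - (1 - r n ^+ 2) * d n x ^+ 2.
Proof. by rewrite energyE /energy gegenbauer_next; ring. Qed.

Lemma energy_ge0 (n : nat) (x : R) : -1 <= x <= 1 -> 0 <= energy n x.
Proof.
move=> /andP[x1 x2]; rewrite energyE addr_ge0 ?sqr_ge0 // mulr_ge0 ?sqr_ge0 //.
nra.
Qed.

Section NonnegativeIndex.
Hypothesis lam_ge0 : 0 <= lam.

Lemma one_sub_r_sqr_ge (n : nat) : 2 * lam / (n.+1%:R + 2 * lam) <= 1 - r n ^+ 2.
Proof.
have D := gegenbauer_den_gt0 hlam n.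
have n0 : (0 : R) < n.+1%:R by [].
have r0 : 0 <= r n by rewrite divr_ge0 // ltW.
have r1 : r n <= 1 by rewrite ler_pdivrMr //; move: lam_ge0; lra.
have -> : 2 * lam / (n.+1%:R + 2 * lam) = 1 - r n.
  by field; rewrite nat1r lt0r_neq0.
nra.
Qed.

Lemma one_sub_r_sqr_ge0 (n : nat) : 0 <= 1 - r n ^+ 2.
Proof.
apply: le_trans (one_sub_r_sqr_ge n); rewrite divr_ge0 ?mulr_ge0 //.
exact/ltW/gegenbauer_den_gt0.
Qed.

Lemma energy_nonincr (n : nat) (x : R) : energy n.+1 x <= energy n x.
Proof.
rewrite energyS lerBlDr lerDl mulr_ge0 ?sqr_ge0 //.
exact: one_sub_r_sqr_ge0.
Qed.

Lemma energy_le (n : nat) (x : R) : energy n x <= 1 - x ^+ 2.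
Proof.
elim: n => [|n IH]; last exact: le_trans (energy_nonincr n x) IH.
by rewrite /energy /= !hornerE; nra.
Qed.

(** The initial energy is [1 - x ^ 2], and [(1 - x ^ 2) G ^ 2] is at most the
    current one. *)
Lemma gegenbauer_le1 (n : nat) (x : R) : -1 <= x <= 1 -> `|(G n).[x]| <= 1.
Proof.
move=> x_in; case: n => [|n]; first by rewrite hornerE normr1.
have [->|x1] := eqVneq x 1; first by rewrite gegenbauer1 // normr1.
have [->|x2] := eqVneq x (-1); first by rewrite gegenbauerN1 // normr_sign.
have x_lt : 0 < 1 - x ^+ 2.
  move: x_in; rewrite !le_eqVlt eq_sym (negbTE x1) (negbTE x2) /=.
  by move=> /andP[? ?]; nra.
rewrite -(@ler_pXn2r _ 2) ?nnegrE // real_normK ?num_real // expr1n.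
rewrite -(ler_pM2l x_lt) mulr1; apply: le_trans (energy_le n x).
by rewrite energyE lerDr sqr_ge0.
Qed.

End NonnegativeIndex.

(** The sum of the dissipated energies is bounded while two consecutive ones
    dominate a multiple of [energy n x / n]; the harmonic series diverges. *)
Lemma gegenbauer_decay (n : nat) (x : R) : 0 < lam -> -1 < x < 1 ->
  lam * (1 - x ^+ 2) * harmonic_sum R n * (G n.+1).[x] ^+ 2 <= 6 * (1 + lam).
Proof.
move=> lam_gt0 /andP[x1 x2].
have lam_ge0 := ltW lam_gt0.
have s_gt0 : 0 < 1 - x ^+ 2 by nra.
have x_in : -1 <= x <= 1 by rewrite !ltW.
pose q := lam * (1 - x ^+ 2) / (3 * (1 + lam)).
have q_gt0 : 0 < q by rewrite divr_gt0 ?mulr_gt0 //; lra.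
have drop m : q / m.+1%:R * energy m x <= energy m x - energy m.+2 x.
  have E1 := energyS m x; have E2 := energyS m.+1 x.
  have g1 := one_sub_r_sqr_ge lam_ge0 m; have g2 := one_sub_r_sqr_ge lam_ge0 m.+1.
  set w := lam / ((1 + lam) * m.+1%:R).
  have m0 : (0 : R) < m.+1%:R by [].
  have w1 : w <= 1 - r m ^+ 2.
    apply: le_trans g1; rewrite /w ler_pdivrMr ?mulr_gt0 //; last by lra.
    rewrite mulrAC ler_pdivlMr ?gegenbauer_den_gt0 //.
    have : (1 : R) <= m.+1%:R by rewrite ler1n.
    by move: m0; set M := m.+1%:R; nra.
  have w2 : w <= 1 - r m.+1 ^+ 2.
    apply: le_trans g2; rewrite /w ler_pdivrMr ?mulr_gt0 //; last by lra.
    rewrite mulrAC ler_pdivlMr ?gegenbauer_den_gt0 //.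
    have : (1 : R) <= m.+1%:R by rewrite ler1n.
    by rewrite -[m.+2%:R]natr1; move: m0; set M := m.+1%:R; nra.
  have w_ge0 : 0 <= w by rewrite divr_ge0 ?mulr_ge0 //; lra.
  (* [d m] may vanish, but then [d m.+1] does not: both terms of the energy are
     combinations of [d m] and [d m.+1] *)
  have ctrl : (1 - x ^+ 2) * energy m x <= 3 * (d m x ^+ 2 + d m.+1 x ^+ 2).
    have dE : (1 - x ^+ 2) * (G m.+1).[x] = x * (r m * d m x) - d m.+1 x.
      by rewrite gegenbauer_next; ring.
    have r_sq : r m ^+ 2 <= 1 by have := one_sub_r_sqr_ge0 lam_ge0 m; lra.
    have -> : (1 - x ^+ 2) * energy m x
      = (1 - x ^+ 2) * d m x ^+ 2 + ((1 - x ^+ 2) * (G m.+1).[x]) ^+ 2.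
      by rewrite energyE; ring.
    rewrite dE.
    move: r_sq; set u := d m x; set v := d m.+1 x; set rm := r m => r_sq.
    have x_sq : x ^+ 2 <= 1 by nra.
    have h1 : (x * (rm * u)) ^+ 2 <= u ^+ 2.
      have -> : (x * (rm * u)) ^+ 2 = x ^+ 2 * rm ^+ 2 * u ^+ 2 by ring.
      have := sqr_ge0 u; have := sqr_ge0 rm; have := sqr_ge0 x => X1 X2 X3.
      have : x ^+ 2 * rm ^+ 2 <= 1 by nra.
      by nra.
    have := sqr_ge0 (x * (rm * u) + v); have := sqr_ge0 u; have := sqr_ge0 x.
    by nra.
  have -> : q / m.+1%:R * energy m x = w / 3 * ((1 - x ^+ 2) * energy m x).
    by rewrite /q /w; field; rewrite nat1r !lt0r_neq0 //; lra.
  have -> : energy m x - energy m.+2 x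
     = (1 - r m ^+ 2) * d m x ^+ 2 + (1 - r m.+1 ^+ 2) * d m.+1 x ^+ 2.
    by rewrite E2 E1; ring.
  apply: (@le_trans _ _ (w * (d m x ^+ 2 + d m.+1 x ^+ 2))).
    move: ctrl w_ge0; set u := (1 - x ^+ 2) * _; set v := _ + _; nra.
  by rewrite mulrDr lerD // ler_wpM2r ?sqr_ge0.
have acc m : energy m x + energy m.+1 x + q * harmonic_sum R m * energy m x
    <= 2 * (1 - x ^+ 2).
  elim: m => [|m IH].
    rewrite /harmonic_sum big_ord0 mulr0 mul0r addr0.
    by have := energy_le lam_ge0 0 x; have := energy_le lam_ge0 1 x; lra.
  apply: le_trans IH.
  have h0 : 0 <= q * harmonic_sum R m.+1.
    by apply: mulr_ge0; [exact: ltW|apply: sumr_ge0].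
  have h1 := ler_wpM2l h0 (energy_nonincr lam_ge0 m x).
  have h2 := drop m.
  have h3 : harmonic_sum R m.+1 = harmonic_sum R m + m.+1%:R^-1.
    by rewrite /harmonic_sum big_ord_recr.
  have h4 : q * harmonic_sum R m.+1 * energy m x =
     q * harmonic_sum R m * energy m x + q / m.+1%:R * energy m x.
    by rewrite h3; ring.
  move: h1 h2; rewrite h4; set u := q / _ * _; set v := q * _ * energy m.+1 x.
  by set w := q * _ * _; lra.
have H := acc n.
have e0 := energy_ge0 n x_in; have e1 := energy_ge0 n.+1 x_in.
have hq : q * harmonic_sum R n * energy n x <= 2 * (1 - x ^+ 2) by lra.
have hs : 0 <= harmonic_sum R n by apply: sumr_ge0.
have h5 : (1 - x ^+ 2) * (G n.+1).[x] ^+ 2 <= energy n x.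
  by rewrite energyE lerDr sqr_ge0.
have h6 := ler_wpM2l (mulr_ge0 (ltW q_gt0) hs) h5.
have h7 : (1 - x ^+ 2) * (q * harmonic_sum R n * (G n.+1).[x] ^+ 2) <= (1 - x ^+ 2) * 2.
  by move: h6 hq; lra.
move: h7; rewrite (ler_pM2l s_gt0) => h7.
have l3 : 0 < 3 * (1 + lam) by lra.
have -> : lam * (1 - x ^+ 2) * harmonic_sum R n * (G n.+1).[x] ^+ 2
  = 3 * (1 + lam) * (q * harmonic_sum R n * (G n.+1).[x] ^+ 2).
  by rewrite /q; field; rewrite lt0r_neq0 //; lra.
by have := ler_wpM2l (ltW l3) h7; lra.
Qed.

Section NegativeIndex.
Hypothesis lam_lt0 : lam < 0.

Lemma deriv_horner_ext (p q : {poly R}) (x : R) :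
  (forall y, p.[y] = q.[y]) -> p^`().[x] = q^`().[x].
Proof. by move=> pq; rewrite !derivE (_ : horner p = horner q) //; apply/funext. Qed.

(** Gegenbauer's differential equation, off its singular points. *)
Lemma gegenbauer_ode (n : nat) (x : R) : -1 < x < 1 ->
  (1 - x ^+ 2) * (G n.+1)^`()^`().[x]
  = (2 * lam + 1) * x * (G n.+1)^`().[x]
    - n.+1%:R * (n.+1%:R + 2 * lam) * (G n.+1).[x].
Proof.
move=> /andP[x1 x2]; have s_neq0 : 1 - x ^+ 2 != 0 by apply: lt0r_neq0; nra.
have down := gegenbauer_deriv_down hlam n x.
have up := gegenbauer_deriv_up hlam n x.
have down' : ((1 - 'X^2) * (G n.+1)^`())^`().[x]
    = (n.+1%:R *: (G n - 'X * G n.+1))^`().[x].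
  apply: deriv_horner_ext => y.
  rewrite hornerM hornerD hornerN hornerXn hornerC (gegenbauer_deriv_down hlam).
  by rewrite hornerZ hornerD hornerN hornerM hornerX.
move: down'; rewrite derivM derivB derivC derivXn derivZ derivB derivM derivX.
rewrite !(hornerD, hornerN, hornerM, hornerX, hornerXn, hornerZ, hornerC, hornerMn) /=.
move: down up; rewrite -[n.+1%:R]natr1.
set A := (G n.+1).[x]; set B := (G n).[x].
set A1 := (G n.+1)^`().[x]; set B1 := (G n)^`().[x].
set A2 := (G n.+1)^`()^`().[x].
set N := n%:R; move=> down up down'.
have N1 : N + 1 != 0 by rewrite natr1.
have B1E : (N + 1) * B1 = (N + 2 * lam) * (x * A1 - (N + 1) * A).
  apply: (mulfI s_neq0).
  transitivity ((N + 1) * ((1 - x ^+ 2) * B1)); first by ring.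
  rewrite up.
  transitivity ((N + 2 * lam)
    * (x * ((1 - x ^+ 2) * A1) - (1 - x ^+ 2) * (N + 1) * A)); last by ring.
  by rewrite down; ring.
have -> : (1 - x ^+ 2) * A2 = (N + 1) * B1 - (N + 1) * (1 * A + x * A1) + 2 * x * A1.
  by move: down'; lra.
by rewrite B1E; ring.
Qed.

(** Sonine's function [G ^ 2 + (1 - x ^ 2) G' ^ 2 / (m (m + 2 lam))]: its
    derivative has the sign of [lam * x], so for a negative index it peaks
    at the origin. *)
Lemma gegenbauer_sqr_le_at0 (n : nat) (x : R) : -1 <= x <= 1 ->
  (G n.+1).[x] ^+ 2
  <= (G n.+1).[0] ^+ 2 + n.+1%:R / (n.+1%:R + 2 * lam) * (G n).[0] ^+ 2.
Proof.
move=> x_in; pose N := n.+1%:R * (n.+1%:R + 2 * lam).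
have D := gegenbauer_den_gt0 hlam n.
have N_gt0 : 0 < N by rewrite mulr_gt0.
pose V : {poly R} := G n.+1 * G n.+1
  + N^-1 *: ((1 - 'X^2) * ((G n.+1)^`() * (G n.+1)^`())).
have VE y : V.[y] = (G n.+1).[y] ^+ 2 + N^-1 * ((1 - y ^+ 2) * (G n.+1)^`().[y] ^+ 2).
  by rewrite /V !(hornerD, hornerN, hornerM, hornerXn, hornerX, hornerZ, hornerC) !expr2.
have V'E y : -1 < y < 1 -> V^`().[y] = 4 * lam * y * (G n.+1)^`().[y] ^+ 2 / N.
  move=> y_in; have ode := gegenbauer_ode n y_in.
  rewrite /V derivD derivZ !derivM derivB derivC derivXn.
  rewrite !(hornerD, hornerN, hornerM, hornerXn, hornerX, hornerZ, hornerC, hornerMn) /=.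
  move: ode; rewrite -/N.
  set A := (G n.+1).[y]; set A1 := (G n.+1)^`().[y].
  set A2 := (G n.+1)^`()^`().[y] => ode.
  transitivity (2 * A * A1 + N^-1 * (2 * A1 * ((1 - y ^+ 2) * A2) - 2 * y * A1 ^+ 2)).
    by ring.
  by rewrite ode; field; exact: lt0r_neq0.
have V0 : V.[0] = (G n.+1).[0] ^+ 2 + n.+1%:R / (n.+1%:R + 2 * lam) * (G n).[0] ^+ 2.
  rewrite VE; congr (_ + _).
  have := gegenbauer_deriv_down hlam n 0.
  rewrite expr0n subr0 mul1r mul0r subr0 mul1r => ->.
  by rewrite /N; field; rewrite nat1r !lt0r_neq0.
rewrite -V0; apply: (@le_trans _ _ V.[x]).
  rewrite VE lerDl; apply: mulr_ge0; first by rewrite invr_ge0 ltW.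
  apply: mulr_ge0; last exact: sqr_ge0.
  by move: x_in => /andP[? ?]; nra.
case/andP: x_in => x1 x2; case: (ltgtP 0 x) => [x0|x0|<-] //.
  have [c] := polyrcf.poly_mvt V x0; rewrite in_itv /= => /andP[c1 c2] E.
  rewrite -subr_le0 E V'E; last by apply/andP; split; lra.
  rewrite -oppr_ge0.
  have -> : - (4 * lam * c * (G n.+1)^`().[c] ^+ 2 / N * (x - 0))
    = 4 * (- lam) * c * (G n.+1)^`().[c] ^+ 2 / N * x by ring.
  apply: mulr_ge0; last by rewrite ltW.
  apply: mulr_ge0; last by rewrite invr_ge0 ltW.
  by apply: mulr_ge0; rewrite ?sqr_ge0 //; move: lam_lt0; nra.
have [c] := polyrcf.poly_mvt V x0; rewrite in_itv /= => /andP[c1 c2] E.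
rewrite -subr_ge0 E V'E; last by apply/andP; split; lra.
have -> : 4 * lam * c * (G n.+1)^`().[c] ^+ 2 / N * (0 - x)
  = 4 * lam * c * (G n.+1)^`().[c] ^+ 2 / N * (- x) by ring.
apply: mulr_ge0; last by lra.
apply: mulr_ge0; last by rewrite invr_ge0 ltW.
by apply: mulr_ge0; rewrite ?sqr_ge0 //; move: lam_lt0; nra.
Qed.

(** At the origin the recurrence is a product of factors
    [1 - 2 lam / m + O(1 / m ^ 2)] over every other [m], at most
    [exp (- 2 lam / m)], which telescopes through [(m - 2) exp (2 / m) <= m].
    The constant comes from the degree [4]. *)
Lemma gegenbauer_at0_le (k : nat) :
  `|(G k.+3).[0]| <= 3 / (2 * (1 + 2 * lam)) * k.+1%:R `^ (- lam).
Proof.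
have l1 : 0 < 1 + 2 * lam by move: hlam; lra.
have C_ge0 : 0 <= 3 / (2 * (1 + 2 * lam)) by rewrite divr_ge0 //; lra.
have step n : (G n.+2).[0] = - (n.+1%:R / (n.+1%:R + 2 * lam) * (G n).[0]).
  have D := lt0r_neq0 (gegenbauer_den_gt0 hlam n).
  apply: (mulfI D); rewrite (gegenbauer_rec hlam).
  by field; rewrite nat1r.
elim/ltn_ind: k => -[|[|k]] IH.
- rewrite step (_ : (G 1).[0] = 0) ?mulr0 ?oppr0 ?normr0; last by rewrite hornerX.
  by rewrite mulr_ge0 ?powR_ge0.
- have -> : (G 4).[0] = 3 / (3 + 2 * lam) * (1 / (1 + 2 * lam)).
    rewrite (step 2%N) (step 0%N) (_ : (G 0).[0] = 1); last by rewrite hornerC.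
    by rewrite mulr1 mulrN opprK.
  rewrite ger0_norm; last by rewrite mulr_ge0 // divr_ge0 //; lra.
  have p1 : 1 <= 2%:R `^ (- lam) :> R.
    have l0 : 0 <= - lam by rewrite oppr_ge0 ltW.
    have two : (1 : R) <= 2%:R by rewrite ler1n.
    by have := ler_powR two l0; rewrite powRr0.
  have -> : 3 / (3 + 2 * lam) * (1 / (1 + 2 * lam))
      = 3 / (2 * (1 + 2 * lam)) * (2 / (3 + 2 * lam)).
    by field; rewrite !lt0r_neq0 //; lra.
  rewrite ler_wpM2l //; apply: le_trans p1.
  by rewrite ler_pdivrMr; lra.
rewrite step normrN normrM ger0_norm; last first.
  by rewrite divr_ge0 // ltW //; exact: gegenbauer_den_gt0.
have D := gegenbauer_den_gt0 hlam k.+3.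
have I := IH k (ltnW (ltnSn _)).
have h0 : 0 <= k.+4%:R / (k.+4%:R + 2 * lam) :> R by rewrite divr_ge0 // ltW.
apply: le_trans (ler_wpM2l h0 I) _.
rewrite mulrCA ler_wpM2l //.
have k3 : (0 : R) < k.+3%:R by [].
have -> : k.+1%:R = k.+3%:R * (1 - 2 / k.+3%:R) :> R.
  rewrite mulrBr mulr1 mulrCA divff ?lt0r_neq0 // mulr1.
  by rewrite -[k.+3%:R]natr1 -[k.+2%:R]natr1; ring.
have y0 : 0 <= 1 - 2 / k.+3%:R :> R.
  by rewrite subr_ge0 ler_pdivrMr // mul1r ler_nat.
rewrite powRM // mulrCA -[leRHS]mulr1 ler_wpM2l ?powR_ge0 //.
have e1 : 1 - 2 / k.+3%:R <= expR (- (2 / k.+3%:R)) :> R := expR_ge1Dx _.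
have l0 : 0 <= - lam by move: lam_lt0; lra.
have := ge0_ler_powR l0 y0 (expR_ge0 _) e1.
rewrite -expRM => e2; apply: le_trans (ler_wpM2l h0 e2) _.
have -> : k.+4%:R / (k.+4%:R + 2 * lam) = 1 + 2 * - lam / (k.+4%:R + 2 * lam) :> R.
  by field; rewrite -natrD; exact: lt0r_neq0.
apply: le_trans (ler_wpM2r (expR_ge0 _) (expR_ge1Dx _)) _.
rewrite -expRD expR_le1.
have -> : - (2 / k.+3%:R) * - lam = - (2 * - lam / k.+3%:R) by ring.
rewrite subr_le0 ler_pM2l; last by move: lam_lt0; lra.
by rewrite lef_pV2 ?posrE // -[k.+4%:R]natr1; move: hlam; lra.
Qed.

Lemma gegenbauer_le_powR (n : nat) (x : R) : -1 <= x <= 1 ->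
  `|(G n.+4).[x]| <= 3 / (1 + 2 * lam) * n.+3%:R `^ (- lam).
Proof.
move=> x_in; have l1 : 0 < 1 + 2 * lam by move: hlam; lra.
set C := 3 / (2 * (1 + 2 * lam)).
have C_ge0 : 0 <= C by rewrite divr_ge0 //; lra.
have mono (m : nat) : (m <= n.+3)%N -> m%:R `^ (- lam) <= n.+3%:R `^ (- lam) :> R.
  by move=> mn; apply: ge0_ler_powR; rewrite ?nnegrE ?ler_nat //; move: lam_lt0; lra.
have at0 m : (m <= n.+1)%N -> (G m.+3).[0] ^+ 2 <= (C * n.+3%:R `^ (- lam)) ^+ 2.
  move=> mn; rewrite -[leLHS]real_normK ?num_real // ler_pXn2r ?nnegrE //.
    apply: le_trans (gegenbauer_at0_le m) _; rewrite ler_wpM2l //.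
    by apply: mono; lia.
  by rewrite mulr_ge0 ?powR_ge0.
have := gegenbauer_sqr_le_at0 n.+3 x_in.
have a0 := at0 n (leqnSn n); have a1 := at0 n.+1 (leqnn _).
have D := gegenbauer_den_gt0 hlam n.+3.
have rho : n.+4%:R / (n.+4%:R + 2 * lam) <= 2 :> R.
  rewrite ler_pdivrMr //.
  have : (4 : R) <= n.+4%:R by rewrite ler_nat.
  by move: hlam; lra.
have rho0 : 0 <= n.+4%:R / (n.+4%:R + 2 * lam) :> R by rewrite divr_ge0 // ltW.
move=> V; rewrite -(@ler_pXn2r _ 2) ?nnegrE //; last first.
  by rewrite mulr_ge0 ?powR_ge0 // divr_ge0 // ltW.
rewrite real_normK ?num_real //; apply: le_trans V _.
have -> : 3 / (1 + 2 * lam) * n.+3%:R `^ (- lam) = 2 * (C * n.+3%:R `^ (- lam)).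
  by rewrite /C; field; exact: lt0r_neq0.
have := ler_wpM2r (sqr_ge0 (G n.+3).[0]) rho.
rewrite exprMn; move: a0 a1; set z := (C * _) ^+ 2.
set s := (G n.+3).[0] ^+ 2; set w := (G n.+4).[0] ^+ 2; set v := _ / _ * s.
have : 0 <= z by rewrite sqr_ge0.
by lra.
Qed.

End NegativeIndex.

End GegenbauerBounds.

(** * The remainder of polynomial interpolation *)

Section InterpolationError.
Variables (R : realType) (a b : R).

Lemma Rolle_zeros (h h' : R -> R) (x : R) (s : seq R) :
  (forall y, a < y < b -> is_derive y 1 h (h' y)) ->
  path <%R x s -> {in x :: s, forall y, a < y < b} ->
  {in x :: s, forall y, h y = 0} ->
  exists s', [/\ size s' = size s, path <%R x s',
    {in s', forall y, a < y < b} & {in s', forall y, h' y = 0}].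
Proof.
move=> dh; elim: s x => [|y s IH] x /=; first by exists [::].
move=> /andP[xy ys] s_in s_0.
have [||s' [size_s' path_s' s'_in s'_0]] := IH y ys.
- by move=> z zs; apply: s_in; rewrite in_cons zs orbT.
- by move=> z zs; apply: s_0; rewrite in_cons zs orbT.
have /andP[ax xb] : a < x < b by apply: s_in; rewrite mem_head.
have /andP[ay yb] : a < y < b by apply: s_in; rewrite !in_cons eqxx orbT.
have [|||c] := @Rolle R h x y xy.
- move=> z; rewrite in_itv /= => /andP[xz zy].
  by have [] : is_derive z 1 h (h' z) by apply: dh; apply/andP; split; lra.
- apply: derivable_within_continuous => z; rewrite in_itv /= => /andP[xz zy].
  by have [] : is_derive z 1 h (h' z) by apply: dh; apply/andP; split; lra.
- by rewrite !s_0 ?mem_head // !in_cons eqxx orbT.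
rewrite in_itv /= => /andP[xc cy] dc.
have c_in : a < c < b by apply/andP; split; lra.
exists (c :: s'); split => /=; first by rewrite size_s'.
- rewrite xc /=; case: s' path_s' {size_s' s'_in s'_0} => //= z s' /andP[yz ->].
  by rewrite (lt_trans cy yz).
- by move=> z; rewrite in_cons => /predU1P[->//|]; exact: s'_in.
- move=> z; rewrite in_cons => /predU1P[->|]; last exact: s'_0.
  by have := @derive_val _ _ _ _ _ _ _ (dh c c_in); rewrite (@derive_val _ _ _ _ _ _ _ dc).
Qed.

Lemma iterated_Rolle_path (n : nat) (h : nat -> R -> R) (x : R) (s : seq R) :
  (forall k y, (k < n)%N -> a < y < b -> is_derive y 1 (h k) (h k.+1 y)) ->
  size s = n -> path <%R x s -> {in x :: s, forall y, a < y < b} ->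
  {in x :: s, forall y, h 0%N y = 0} ->
  exists2 y, a < y < b & h n y = 0.
Proof.
elim: n h x s => [|n IH] h x s dh size_s xs s_in s_0.
  by exists x; [apply: s_in|apply: s_0]; rewrite mem_head.
have [|[|z s'] []] := @Rolle_zeros (h 0%N) (h 1%N) x s _ xs s_in s_0.
- by move=> w; exact: dh.
- by rewrite size_s.
rewrite size_s => -[size_s'] /= /andP[_ zs'] s'_in s'_0.
have [|w w_in hw] := IH (fun k => h k.+1) z s' _ size_s' zs' s'_in s'_0.
  by move=> k y kn; exact: dh.
by exists w.
Qed.

Lemma iterated_Rolle (n : nat) (h : nat -> R -> R) (s : seq R) :
  (forall k y, (k < n)%N -> a < y < b -> is_derive y 1 (h k) (h k.+1 y)) ->
  size s = n.+1 -> uniq s -> {in s, forall y, a < y < b} ->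
  {in s, forall y, h 0%N y = 0} ->
  exists2 y, a < y < b & h n y = 0.
Proof.
move=> dh size_s s_uniq s_in s_0.
have : sorted <%R (sort <=%R s) by rewrite sort_lt_sorted.
have : {in sort <=%R s, forall y, a < y < b}.
  by move=> y; rewrite mem_sort; exact: s_in.
have : {in sort <=%R s, forall y, h 0%N y = 0}.
  by move=> y; rewrite mem_sort; exact: s_0.
move: size_s; rewrite -(size_sort <=%R s).
case: (sort _ s) => //= x s' [size_s'] s'_0 s'_in xs'.
exact: iterated_Rolle_path dh size_s' xs' s'_in s'_0.
Qed.

Lemma derivn_size_le (p : {poly R}) (n : nat) : (size p <= n.+1)%N ->
  p^`(n) = (p`_n *+ n`!)%:P.
Proof.
move=> size_p; apply/polyP => -[|i]; rewrite coef_derivn coefC /=.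
  by rewrite addn0 ffactnn.
by rewrite nth_default ?mul0rn // (leq_trans size_p) // addnS ltnS leq_addr.
Qed.

(** Cauchy's remainder: with [c] chosen so that [f - p - c * prod] also
    vanishes at [x], its derivative of order [n + 1] vanishes somewhere, and
    there [f ^ (n + 1) = c * (n + 1)!]. *)
Lemma interpolation_remainder (f : R -> R) (n : nat) (s : seq R) (p : {poly R})
    (x : R) :
  (forall k y, (k <= n)%N -> a < y < b -> derivable (derive1n k f) y 1) ->
  size s = n.+1 -> uniq s -> {in s, forall y, a < y < b} ->
  (size p <= n.+1)%N -> {in s, forall y, p.[y] = f y} -> a < x < b ->
  exists2 y, a < y < b &
    f x - p.[x] = derive1n n.+1 f y / n.+1`!%:R * \prod_(z <- s) (x - z).
Proof.
move=> df size_s s_uniq s_in size_p ps x_in.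
pose w : {poly R} := \prod_(z <- s) ('X - z%:P).
have wE y : w.[y] = \prod_(z <- s) (y - z).
  by rewrite horner_prod; apply: eq_bigr => z _; rewrite hornerXsubC.
have [xs|xs] := boolP (x \in s).
  exists x => //; rewrite ps // subrr -wE.
  by have /rootP -> : root w x; rewrite ?mulr0 // root_prod_XsubC.
have wx_neq0 : w.[x] != 0 by rewrite -[_ == 0]/(root w x) root_prod_XsubC.
pose c := (f x - p.[x]) / w.[x].
pose q := p + c *: w.
pose h k y := derive1n k f y - (q^`(k)).[y].
have [|||||y y_in hy] := @iterated_Rolle n.+1 h (x :: s).
- move=> k y kn y_in; rewrite /h.
  have d1 : is_derive y 1 (derive1n k f) (derive1n k.+1 f y).
    by rewrite derive1nS derive1E; apply: DeriveDef => //; exact: df.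
  by rewrite derivnS; exact: is_deriveB.
- by rewrite /= size_s.
- by rewrite /= xs.
- by move=> y; rewrite in_cons => /predU1P[->//|]; exact: s_in.
- move=> y; rewrite in_cons /h derivn0 derive1n0 /q hornerD hornerZ.
  move=> /predU1P[->|ys]; first by rewrite /c divfK // subrKC subrr.
  have /rootP -> : root w y by rewrite root_prod_XsubC.
  by rewrite mulr0 addr0 ps // subrr.
exists y => //; rewrite -wE.
have size_w : size w = n.+2 by rewrite size_prod_XsubC size_s.
have w_monic : w`_n.+1 = 1.
  by have /monicP := monic_prod_XsubC s xpredT id; rewrite -/w lead_coefE size_w.
move: hy; rewrite /h derivn_size_le; last first.
  rewrite (leq_trans (size_polyD _ _)) // geq_max (leq_trans size_p) //=.
  by rewrite (leq_trans (size_scale_leq _ _)) // size_w.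
rewrite hornerC /q coefD coefZ w_monic nth_default // add0r mulr1.
move=> /eqP; rewrite subr_eq0 => /eqP ->.
by rewrite -[c *+ _]mulr_natr mulfK ?pnatr_eq0 -?lt0n ?fact_gt0 // /c divfK.
Qed.

End InterpolationError.

Lemma interpolant_exists (R : fieldType) (f : R -> R) (s : seq R) : uniq s ->
  exists2 p : {poly R}, (size p <= size s)%N & {in s, forall y, p.[y] = f y}.
Proof.
elim: s => [|x s IH] /=; first by exists 0; rewrite ?size_poly0.
move=> /andP[xs s_uniq]; have [p size_p ps] := IH s_uniq.
pose w : {poly R} := \prod_(z <- s) ('X - z%:P).
have wx_neq0 : w.[x] != 0 by rewrite -[_ == 0]/(root w x) root_prod_XsubC.
exists (p + ((f x - p.[x]) / w.[x]) *: w).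
  rewrite (leq_trans (size_polyD _ _)) // geq_max (leq_trans size_p) //=.
  by rewrite (leq_trans (size_scale_leq _ _)) // size_prod_XsubC.
move=> y; rewrite in_cons hornerD hornerZ.
move=> /predU1P[->|ys]; first by rewrite divfK // subrKC.
have /rootP -> : root w y by rewrite root_prod_XsubC.
by rewrite mulr0 addr0 ps.
Qed.

(** * Pointwise bounds from the essential supremum *)

Section SupremumNorm.
Variable R : realType.
Local Notation mu := (@lebesgue_measure R).

(** The points where a continuous function exceeds a bound form an open set,
    which is not negligible unless it is empty. *)
Lemma continuous_le_ess_sup (g : R -> R) (M : \bar R) (x : R) :
  (\forall y \ae mu, (`|g y|%:E <= M)%E) -> {for x, continuous g} ->
  (`|g x|%:E <= M)%E.
Proof.
move=> [N [mN N0 subN]] cg; rewrite leNgt; apply/negP => Mx.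
have : \forall y \near x, (M < `|g y|%:E)%E.
  case: M Mx {subN} => [r|//|]; last first.
    by move=> _; exists 1 => //= y _; rewrite ltNyr.
  rewrite lte_fin => rx; have ca : (fun y => `|g y|) @ x --> `|g x| by exact: cvg_norm.
  have er : 0 < `|g x| - r by rewrite subr_gt0.
  have [d /= d0 dP] := (iffLR (cvgrPdist_lt _ _)) ca _ er.
  exists d => //= y /dP; rewrite lte_fin.
  by move=> /(le_lt_trans (ler_norm _)); lra.
move=> /nbhs_ballP[d /= d_gt0 dP].
have sub : ball x d `<=` N.
  by move=> y /dP My; apply: subN => /=; apply/negP; rewrite -ltNge.
have : (mu (ball x d) <= mu N)%E.
  apply: le_measure; rewrite ?inE //.
  by rewrite ball_itv; exact: measurable_itv.
rewrite N0 lebesgue_measure_ball; last exact: ltW.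
by rewrite leNgt lte_fin pmulrn_lgt0 // d_gt0.
Qed.

Lemma deriv_norm_fin_num (m : nat) (f : R -> R) : C01 m f ->
  ('N[mu]_(+oo)[EFin \o (derive1n m f \_ `[0%R, 1%R])])%E \is a fin_num.
Proof.
case=> _ _ /(_ m (leqnn m)) [g cg fg].
rewrite ge0_fin_numE ?Lnorm_ge0 //.
have [M [_ Mg]] : bounded_set (g @` `[0, 1]).
  by apply: compact_bounded; apply: continuous_compact => //; exact: segment_compact.
apply: (@le_lt_trans _ _ (`|M| + 1)%:E); last exact: ltry.
rewrite unlock; case: ifP => _; last by rewrite lee_fin addr_ge0.
apply/ess_supP; exists [set 0; 1]; split.
- exact: measurableU.
- apply: countable_lebesgue_measure0; apply: finite_set_countable.
  exact: finite_set2.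
- move=> x /= /negP; rewrite -ltNge => h.
  apply: contrapT => /not_orP[x0 x1]; move: h; apply/negP; rewrite -leNgt.
  rewrite lee_fin patchE; case: ifPn => [|_]; last by rewrite normr0 addr_ge0.
  rewrite inE /= in_itv /= => /andP[x0' x1'].
  have x_in : 0 < x < 1.
    by rewrite !lt_neqAle x0' x1' !andbT eq_sym; apply/andP; split; apply/eqP.
  rewrite fg //; apply: Mg; first by rewrite (le_lt_trans (ler_norm M)) // ltrDl.
  by exists x => //=; rewrite in_itv /= x0' x1'.
Qed.

Lemma normr_derive1n_le (m : nat) (f : R -> R) (x : R) : C01 m.+1 f -> 0 < x < 1 ->
  `|derive1n m f x| <= deriv_norm m f.
Proof.
move=> fC x_in; have fCm : C01 m f.
  case: fC => cf df gf; split => //; first by move=> k y km; apply: df; exact: ltnW.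
  by move=> k km; apply: gf; exact: leqW.
have N_fin := deriv_norm_fin_num fCm.
rewrite -lee_fin /deriv_norm fineK //.
pose g := derive1n m f \_ `[0, 1].
have gx : g x = derive1n m f x.
  by rewrite /g patchE ifT // inE /= in_itv /=; case/andP: x_in => /ltW -> /ltW ->.
rewrite -gx; apply: continuous_le_ess_sup.
  rewrite unlock; case: ifP => [_|/negP muT]; first exact: ess_sup_ge.
  case: muT; apply: (@lt_le_trans _ _ (mu (ball (0 : R) 1))).
    by rewrite lebesgue_measure_ball ?ler01 // lte_fin pmulrn_lgt0.
  by apply: le_measure; rewrite ?inE //; by rewrite ball_itv; exact: measurable_itv.
have cf : {for x, continuous (derive1n m f)}.
  apply/differentiable_continuous/derivable1_diffP.
  by case: fC => _ df _; exact: df.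
rewrite /prop_for /continuous_at gx; apply: cvg_trans cf.
apply: near_eq_cvg; near=> y.
rewrite /g patchE ifT // inE /= in_itv /=; apply/andP; split; apply: ltW; near: y.
  by apply: lt_nbhsr; case/andP: x_in.
by apply: lt_nbhsl; case/andP: x_in.
Unshelve. all: by end_near. Qed.

End SupremumNorm.

(** * Integrals against the Riemann-Liouville kernel *)

Section Integrals.
Variable R : realType.
Local Notation mu := (@lebesgue_measure R).

Lemma integral_is_derive (f F : R -> R) (a b : R) : a < b ->
  (forall x, a <= x <= b -> is_derive x 1 F (f x)) ->
  (forall x, a <= x <= b -> {for x, continuous f}) ->
  (\int[mu]_(x in `[a, b]) (f x)%:E = (F b - F a)%:E)%E.
Proof.
move=> ab dF cf.
have cF x : a <= x <= b -> {for x, continuous F}.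
  by move=> /dF -[dx _]; exact/differentiable_continuous/derivable1_diffP.
rewrite (continuous_FTC2 (F := F) ab) ?EFinB //.
- apply: continuous_in_subspaceT => x; rewrite inE /= in_itv /=; exact: cf.
- split.
  + move=> x; rewrite in_itv /= => /andP[/ltW ax /ltW xb].
    by have [] := dF x (introT andP (conj ax xb)).
  + by apply: cvg_at_right_filter; apply: cF; rewrite lexx ltW.
  + by apply: cvg_at_left_filter; apply: cF; rewrite lexx ltW.
- move=> x; rewrite in_itv /= => /andP[/ltW ax /ltW xb].
  by rewrite derive1E; have [_ ->] := dF x (introT andP (conj ax xb)).
Qed.

Section Kernel.
Variables (alpha t : R).
Hypothesis alpha_gt0 : 0 < alpha.
Local Notation k x := ((t - x) `^ (alpha - 1)).

Lemma measurable_kernel (D : set R) : measurable D ->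
  measurable_fun D (fun x => (k x)%:E).
Proof.
move=> mD; apply/measurable_EFinP.
apply: (@measurable_funS _ _ _ _ setT) => //.
apply: (measurableT_comp (measurable_powR _)).
exact: measurable_funB.
Qed.

Lemma is_derive_sub_powR (p x : R) : x < t ->
  is_derive x 1 (fun x => (t - x) `^ p) (- (p * (t - x) `^ (p - 1))).
Proof.
move=> xt; have d1 : is_derive x 1 (fun x => t - x) (-1).
  by have := is_deriveB (is_derive_cst t x (1 : R)) (is_derive_id x (1 : R)); rewrite sub0r.
have tx : 0 < t - x by rewrite subr_gt0.
have := @is_derive1_comp R (@powR R ^~ p) (fun x => t - x) x _ _ (is_derive1_powR p tx) d1.
by rewrite mulrN1.
Qed.

(** The singularity at [t] is approached by the intervals [[a, b i]], on which
    the fundamental theorem of calculus applies. *)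
Lemma integral_kernel_le (a : R) : a <= t ->
  (\int[mu]_(x in `[a, t]) (k x)%:E <= ((t - a) `^ alpha / alpha)%:E)%E.
Proof.
rewrite le_eqVlt => /predU1P[->|a_t].
  by rewrite set_itv1 integral_set1 lee_fin divr_ge0 ?powR_ge0 // ltW.
pose b (i : nat) := t - (t - a) / i.+2%:R.
have ta : 0 < t - a by rewrite subr_gt0.
have b_lt i : b i < t by rewrite /b ltrBlDr ltrDl divr_gt0.
have a_b i : a < b i.
  rewrite /b ltrBrDl -ltrBrDr ltr_pdivrMr // ltr_pMr //.
  by rewrite ltr1n.
have b_mono i j : (i <= j)%N -> b i <= b j.
  move=> ij; rewrite /b lerD2l lerN2 ler_pM2l // lef_pV2 ?posrE //.
  by rewrite ler_nat !ltnS.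
rewrite -integral_itv_bndo_bndc; last exact: measurable_kernel.
have -> : `[a, t[%classic = \bigcup_i `[a, b i]%classic.
  apply/seteqP; split => [x|x [i _]] /=; rewrite !in_itv /=; last first.
    by move=> /andP[-> xb]; exact: le_lt_trans xb (b_lt i).
  move=> /andP[ax xt]; have tx : 0 < t - x by rewrite subr_gt0.
  exists (Num.truncn ((t - a) / (t - x))) => //=; rewrite in_itv /= ax /b /=.
  rewrite lerBrDr -lerBrDl ler_pdivrMr // mulrC -ler_pdivrMr //.
  apply: ltW; apply: lt_trans (truncnS_gt _) _.
  by rewrite ltr_nat.
apply: (cvge_to_le (ge0_nondecreasing_set_cvg_integral _ _ _ _)).
- move=> i j ij; apply/subsetPset => x /=; rewrite !in_itv /= => /andP[-> xb].
  exact: le_trans xb (b_mono i j ij).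
- by move=> i; exact: measurable_itv.
- by move=> i; exact: measurable_kernel.
- by move=> i x _; rewrite lee_fin powR_ge0.
apply: nearW => i; pose F x := - ((t - x) `^ alpha / alpha).
have -> : (\int[mu]_(x in `[a, b i]) (k x)%:E = (F (b i) - F a)%:E)%E.
  apply: integral_is_derive => // x /andP[_ xb]; have xt := le_lt_trans xb (b_lt i).
    have := is_deriveN (is_deriveM (is_derive_sub_powR alpha xt)
                                   (is_derive_cst alpha^-1 x (1 : R))).
    rewrite scaler0 add0r /GRing.scale /= mulrN opprK mulKf ?gt_eqF //.
  have [d _] := is_derive_sub_powR (alpha - 1) xt.
  exact/differentiable_continuous/derivable1_diffP.
rewrite /F lee_fin opprK addrC lerBlDr lerDl divr_ge0 ?powR_ge0 //.
exact: ltW.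
Qed.

Lemma integrable_kernel (a : R) : a <= t ->
  mu.-integrable `[a, t] (fun x => (k x)%:E).
Proof.
move=> a_t; apply/integrableP; split; first exact: measurable_kernel.
apply: (@le_lt_trans _ _ ((t - a) `^ alpha / alpha)%:E); last exact: ltry.
apply: le_trans (integral_kernel_le a_t).
by under eq_integral => x _ do rewrite gee0_abs ?lee_fin ?powR_ge0 //.
Qed.

Lemma integrable_kernel_mul (a : R) (h : R -> R) : a <= t ->
  {within `[a, t], continuous h} ->
  mu.-integrable `[a, t] (EFin \o (fun x => k x * h x)).
Proof.
move=> a_t ch.
have [M [_ Mh]] : bounded_set (h @` `[a, t]).
  by apply: compact_bounded; apply: continuous_compact => //; exact: segment_compact.
have mh : measurable_fun `[a, t] h by apply: subspace_continuous_measurable_fun.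
apply: (@le_integrable _ _ _ mu _ _ _ (fun x => ((`|M| + 1) * k x)%:E)) => //.
- apply/measurable_EFinP; apply: measurable_funM => //.
  by apply/measurable_EFinP; exact: measurable_kernel.
- move=> x xat; rewrite /= lee_fin normrM [leRHS]ger0_norm ?mulr_ge0 ?powR_ge0 ?addr_ge0 //.
  rewrite ger0_norm ?powR_ge0 // mulrC ler_wpM2r ?powR_ge0 //.
  apply: Mh; first by rewrite (le_lt_trans (ler_norm M)) // ltrDl.
  by exists x.
- have kM : mu.-integrable `[a, t] (fun x => (`|M| + 1)%:E * (k x)%:E)%E.
    by apply: integrableZl => //; exact: integrable_kernel.
  exact: kM.
Qed.

End Kernel.

End Integrals.

Section FractionalIntegral.
Variable R : realType.
Local Notation mu := (@lebesgue_measure R).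

Lemma Gamma_ge0 (alpha : R) : 0 <= Gamma alpha.
Proof. by apply: Rintegral_ge0 => x _; rewrite mulr_ge0 ?powR_ge0 ?expR_ge0. Qed.

Definition kernel_integral (alpha t : R) (w : {poly R}) : R :=
  \int[mu]_(x in `[0, t]) ((t - x) `^ (alpha - 1) * `|w.[x]|).

Lemma continuous_normr_horner (w : {poly R}) (A : set R) :
  {within A, continuous (fun x => `|w.[x]|)}.
Proof.
apply: continuous_subspaceT => x.
by apply: cvg_norm; exact: continuous_horner.
Qed.

Lemma Rintegral_itv_oo_cc (a b : R) (g : R -> R) :
  mu.-integrable `[a, b] (EFin \o g) ->
  \int[mu]_(x in `]a, b[) g x = \int[mu]_(x in `[a, b]) g x.
Proof.
move=> ig; rewrite Rintegral_itv_bndo_bndc; last first.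
  by apply: integrableS ig => //; exact: subset_itv_oo_cc.
rewrite Rintegral_itv_obnd_cbnd //.
by apply: integrableS ig => //; exact: subset_itv_oc_cc.
Qed.

(** The endpoints, where the error is not controlled, are negligible. *)
Lemma RL_integral_sub_le (alpha t M : R) (f : R -> R) (p w : {poly R}) :
  0 < alpha -> 0 <= t <= 1 -> {within `[0, 1], continuous f} ->
  (forall x, 0 < x < 1 -> `|f x - p.[x]| <= M * `|w.[x]|) ->
  `|RL_integral alpha f t - RL_integral alpha (fun x => p.[x]) t|
  <= (Gamma alpha)^-1 * (M * kernel_integral alpha t w).
Proof.
move=> alpha_gt0 /andP[t0 t1] cf fpw.
have cft : {within `[0, t], continuous f}.
  by apply: continuous_subspaceW cf; apply: subset_itvl; rewrite bnd_simp.
have cp : {within `[0, t], continuous (fun x => p.[x])}.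
  by apply: continuous_subspaceT => x; exact: continuous_horner.
have if_ := integrable_kernel_mul alpha_gt0 t0 cft.
have ip := integrable_kernel_mul alpha_gt0 t0 cp.
have iw := integrable_kernel_mul alpha_gt0 t0
  (@continuous_normr_horner w `[0, t]).
rewrite /RL_integral -mulrBr normrM ger0_norm ?invr_ge0 ?Gamma_ge0 //.
rewrite ler_wpM2l ?invr_ge0 ?Gamma_ge0 //.
rewrite -RintegralB // /kernel_integral -RintegralZl //.
have ifp : mu.-integrable `[0, t]
    (EFin \o (fun x => (t - x) `^ (alpha - 1) * f x - (t - x) `^ (alpha - 1) * p.[x])).
  have := @integrableB _ _ _ mu `[0, t] (measurable_itv _) _ _ if_ ip.
  by apply: eq_integrable.
apply: le_trans (le_normr_Rintegral _ ifp) _ => //.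
have in_ : mu.-integrable `[0, t]
    (EFin \o (fun x => `|(t - x) `^ (alpha - 1) * f x - (t - x) `^ (alpha - 1) * p.[x]|)).
  exact: (integrable_norm ifp).
have iMw : mu.-integrable `[0, t]
    (EFin \o (fun x => M * ((t - x) `^ (alpha - 1) * `|w.[x]|))).
  have H := @integrableZl _ _ _ mu `[0, t] (measurable_itv _) M _ iw.
  exact: H.
rewrite -(Rintegral_itv_oo_cc in_) -(Rintegral_itv_oo_cc iMw).
apply: le_Rintegral => //.
- by apply: integrableS in_ => //; exact: subset_itv_oo_cc.
- by apply: integrableS iMw => //; exact: subset_itv_oo_cc.
move=> x; rewrite /= in_itv /= => /andP[x0 xt].
rewrite -mulrBr normrM ger0_norm ?powR_ge0 // mulrCA ler_wpM2l ?powR_ge0 //.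
by apply: fpw; rewrite x0 (lt_le_trans xt).
Qed.

Section KernelIntegralBounds.
Variables (alpha t : R).
Hypotheses (alpha_gt0 : 0 < alpha) (t_ge0 : 0 <= t).

Lemma Rintegral_kernel_le (a : R) : a <= t ->
  \int[mu]_(x in `[a, t]) (t - x) `^ (alpha - 1) <= (t - a) `^ alpha / alpha.
Proof.
move=> a_t; rewrite -lee_fin fineK; first exact: integral_kernel_le.
by apply: integrable_fin_num => //; exact: integrable_kernel.
Qed.

Lemma kernel_integral_le (S : R) (w : {poly R}) :
  (forall x, 0 <= x <= t -> `|w.[x]| <= S) ->
  kernel_integral alpha t w <= S * (t `^ alpha / alpha).
Proof.
move=> wS; have S_ge0 : 0 <= S by apply: le_trans (wS 0 _); rewrite ?lexx.
apply: (@le_trans _ _ (\int[mu]_(x in `[0, t]) (S * (t - x) `^ (alpha - 1)))).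
  apply: le_Rintegral => //.
  - exact: (integrable_kernel_mul alpha_gt0 t_ge0
      (@continuous_normr_horner w `[0, t])).
  - have H := @integrableZl _ _ _ mu `[0, t] (measurable_itv _) S _
      (integrable_kernel alpha_gt0 t_ge0).
    exact: H.
  - move=> x; rewrite /= in_itv /= => x_in.
    by rewrite mulrC ler_wpM2r ?powR_ge0 // wS.
rewrite RintegralZl //; last exact: integrable_kernel.
rewrite ler_wpM2l //.
by have := Rintegral_kernel_le t_ge0; rewrite subr0.
Qed.

Lemma integrable_normr_horner (a b : R) (w : {poly R}) :
  mu.-integrable `[a, b] (EFin \o (fun x => `|w.[x]|)).
Proof.
apply: continuous_compact_integrable; first exact: segment_compact.
exact: continuous_normr_horner.
Qed.

(** Near its singularity the kernel has a small integral, and it is bounded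
    elsewhere. *)
Lemma kernel_integral_le_L1 (d : R) (w : {poly R}) : 0 < d -> alpha < 1 -> t <= 1 ->
  (forall x, 0 <= x <= 1 -> `|w.[x]| <= 1) ->
  kernel_integral alpha t w
  <= d `^ alpha / alpha + d `^ (alpha - 1) * \int[mu]_(x in `[0, 1]) `|w.[x]|.
Proof.
move=> d_gt0 alpha_lt1 t_le1 w_le1.
have L1_ge0 : 0 <= d `^ (alpha - 1) * \int[mu]_(x in `[0, 1]) `|w.[x]|.
  by rewrite mulr_ge0 ?powR_ge0 //; apply: Rintegral_ge0.
have w_le1' x : 0 <= x <= t -> `|w.[x]| <= 1.
  by move=> /andP[x0 xt]; apply: w_le1; rewrite x0 (le_trans xt).
case: (leP t d) => td.
  apply: le_trans (kernel_integral_le w_le1') _; rewrite mul1r.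
  rewrite -[leLHS]addr0 lerD // ler_wpM2r ?invr_ge0 ?(ltW alpha_gt0) //.
  by apply: ge0_ler_powR => //; [exact: ltW|rewrite nnegrE ltW].
have iw := integrable_kernel_mul alpha_gt0 t_ge0
  (@continuous_normr_horner w `[0, t]).
have a0 : 0 <= t - d by rewrite subr_ge0 ltW.
have at_ : t - d <= t by rewrite lerBlDr lerDl ltW.
have split_ := Rintegral_itvB iw (_ : (BLeft 0 <= BRight (t - d))%O)
  (_ : (BRight (t - d) <= BRight t)%O).
rewrite /kernel_integral -[leLHS](subrK
  (\int[mu]_(x in `[0, t - d]) ((t - x) `^ (alpha - 1) * `|w.[x]|))).
rewrite split_ ?bnd_simp //; apply: lerD.
  rewrite Rintegral_itv_obnd_cbnd; last first.
    by apply: integrableS iw => //; apply: subset_itv; rewrite bnd_simp.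
  apply: (@le_trans _ _ (\int[mu]_(x in `[t - d, t]) (t - x) `^ (alpha - 1))).
    apply: le_Rintegral => //.
    + by apply: integrableS iw => //; apply: subset_itv; rewrite bnd_simp.
    + exact: integrable_kernel.
    + move=> x; rewrite /= in_itv /= => /andP[xa xt].
      rewrite -[leRHS]mulr1 ler_wpM2l ?powR_ge0 // w_le1' //.
      by rewrite xt (le_trans a0 xa).
  by have := Rintegral_kernel_le at_; rewrite subKr.
have L1_sub : \int[mu]_(x in `[0, t - d]) `|w.[x]| <= \int[mu]_(x in `[0, 1]) `|w.[x]|.
  have sub : `[0, t - d] `<=` `[(0 : R), 1].
    by apply: subset_itvl; rewrite bnd_simp (le_trans at_).
  rewrite /Rintegral fine_le //.
  - by apply: integrable_fin_num => //; exact: integrable_normr_horner.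
  - by apply: integrable_fin_num => //; exact: integrable_normr_horner.
  apply: ge0_subset_integral => //.
  by case/integrableP: (integrable_normr_horner 0 1 w).
apply: le_trans (ler_wpM2l (powR_ge0 _ _) L1_sub).
rewrite -RintegralZl //; last exact: integrable_normr_horner.
apply: le_Rintegral => //.
- by apply: integrableS iw => //; apply: subset_itvl; rewrite bnd_simp.
- have H := @integrableZl _ _ _ mu `[0, t - d] (measurable_itv _) (d `^ (alpha - 1)) _
    (integrable_normr_horner 0 (t - d) w).
  exact: H.
move=> x; rewrite /= in_itv /= => /andP[x0 xd].
rewrite ler_wpM2r //.
have dx : d <= t - x by rewrite lerBrDr -lerBrDl.
have tx : 0 < t - x := lt_le_trans d_gt0 dx.
rewrite -[alpha - 1]opprB !powRN lef_pV2 ?posrE ?powR_gt0 //.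
by apply: ge0_ler_powR; rewrite ?nnegrE ?(ltW tx) ?(ltW d_gt0) // subr_ge0 ltW.
Qed.

End KernelIntegralBounds.

Lemma Rintegral_normr_cvg0 (w : nat -> {poly R}) :
  (forall n x, 0 <= x <= 1 -> `|(w n).[x]| <= 1) ->
  (forall x, 0 < x < 1 -> (w n).[x] @[n --> \oo] --> (0 : R)) ->
  \int[mu]_(x in `[0, 1]) `|(w n).[x]| @[n --> \oo] --> (0 : R).
Proof.
move=> w_le1 w_cvg.
have [] := @dominated_convergence _ _ _ mu `[(0 : R), 1] (measurable_itv _)
  (fun n x => (`|(w n).[x]|)%:E) (cst 0%E) (cst 1%E).
- by move=> n; case/integrableP: (integrable_normr_horner 0 1 (w n)).
- exact: measurable_cst.
- exists [set 0; 1]; split.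
  + exact: measurableU.
  + by apply: countable_lebesgue_measure0; apply: finite_set_countable; exact: finite_set2.
  + move=> x /= /not_implyP[x_in nc]; apply: contrapT => /not_orP[x0 x1]; apply: nc.
    move: x_in; rewrite in_itv /= => /andP[x0' x1'].
    apply: cvg_EFin; first exact: nearW.
    rewrite -(normr0 R); apply: cvg_norm; apply: w_cvg.
    by rewrite !lt_neqAle x0' x1' !andbT eq_sym; apply/andP; split; apply/eqP.
- apply/integrableP; split; first exact: measurable_cst.
  under eq_integral => x _ do rewrite /= normr1.
  by rewrite integral_cst //= mul1e lebesgue_measure_itv /= lte_fin ltr01 oppr0 adde0 ltry.
- apply: nearW => x n; rewrite /= in_itv /= => x_in.
  by rewrite lee_fin normr_id; exact: w_le1.
move=> _ _; rewrite integral_cst // mul0e => h.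
exact: (fine_cvg h).
Qed.

Lemma kernel_integral_small (alpha e : R) (w : nat -> {poly R}) :
  0 < alpha < 1 -> 0 < e ->
  (forall n x, 0 <= x <= 1 -> `|(w n).[x]| <= 1) ->
  (forall x, 0 < x < 1 -> (w n).[x] @[n --> \oo] --> (0 : R)) ->
  \forall n \near \oo, forall t, 0 <= t <= 1 -> kernel_integral alpha t (w n) <= e.
Proof.
move=> /andP[alpha_gt0 alpha_lt1] e_gt0 w_le1 w_cvg.
(* the width [d] gives the singular part the integral [e / 2] *)
pose d := (e * alpha / 2) `^ alpha^-1.
have b_gt0 : 0 < e * alpha / 2 by rewrite divr_gt0 ?mulr_gt0.
have d_gt0 : 0 < d by rewrite powR_gt0.
have dE : d `^ alpha / alpha = e / 2.
  rewrite /d -powRrM mulVf ?gt_eqF // powRr1 ?ltW //.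
  by field; rewrite gt_eqF.
have L1 := Rintegral_normr_cvg0 w_le1 w_cvg.
have h_gt0 : 0 < e / 2 / d `^ (alpha - 1) by rewrite !divr_gt0 ?powR_gt0.
have L1_small : \forall n \near \oo,
    \int[mu]_(x in `[0, 1]) `|(w n).[x]| < e / 2 / d `^ (alpha - 1).
  have H := (iffLR (cvgrPdist_lt _ _)) L1 _ h_gt0.
  case: H => N _ HN; exists N => // n /HN /=; rewrite sub0r normrN.
  exact: le_lt_trans (ler_norm _).
near=> n => t /andP[t0 t1].
apply: le_trans (kernel_integral_le_L1 alpha_gt0 t0 d_gt0 alpha_lt1 t1 (w_le1 n)) _.
rewrite dE [leRHS](splitr e) lerD2l.
rewrite mulrC -ler_pdivlMr ?powR_gt0 //.
apply: ltW; near: n; exact: L1_small.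
Unshelve. all: by end_near. Qed.

End FractionalIntegral.

(** * A lower bound for the Gamma function *)

Section GammaLowerBound.
Variable R : realType.
Local Notation mu := (@lebesgue_measure R).

Lemma sqr_onem_half_le_expRN (x : R) : 0 <= x <= 2 -> (1 - x / 2) ^+ 2 <= expR (- x).
Proof.
move=> /andP[x0 x2].
have -> : expR (- x) = expR (- (x / 2)) ^+ 2 by rewrite -expRM_natl; congr expR; lra.
rewrite ler_pXn2r ?nnegrE ?expR_ge0 //; last by lra.
exact: expR_ge1Dx.
Qed.

(** [exp (- x) >= (1 - x / 2) ^ 2] on [[0, 2]] turns the Gamma integral into a
    Beta integral.  A divergent integral takes the value [0], so the hypothesis
    [0 < Gamma alpha] says that the Gamma integral converges. *)
Lemma Gamma_ge (alpha : R) : 0 < alpha -> 0 < Gamma alpha ->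
  2 * 2 `^ alpha / (alpha * (alpha + 1) * (alpha + 2)) <= Gamma alpha.
Proof.
move=> alpha_gt0 Gamma_gt0.
pose g x : R := x `^ (alpha - 1) * (1 - x / 2) ^+ 2.
(* [F] is the antiderivative of [g] vanishing at [0] *)
pose q : {poly R} := alpha^-1%:P - (alpha + 1)^-1 *: 'X + (4 * (alpha + 2))^-1 *: 'X^2.
pose F x := x `^ alpha * q.[x].
have qE x : q.[x] = alpha^-1 - (alpha + 1)^-1 * x + (4 * (alpha + 2))^-1 * x ^+ 2.
  by rewrite /q !(hornerD, hornerN, hornerC, hornerZ, hornerXn, hornerX).
have dF (x : R) : 0 < x -> is_derive x 1 F (g x).
  move=> x_gt0; have H := is_deriveM (is_derive1_powR alpha x_gt0) (is_derive_poly q x).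
  apply: (is_derive_eq H); rewrite /g /GRing.scale /= -(mulr_powRB1 (ltW x_gt0) alpha_gt0) qE.
  rewrite /q !(derivD, derivN, derivB, derivC, derivZ, derivX, derivXn).
  rewrite !(hornerD, hornerN, hornerC, hornerZ, hornerXn, hornerX, hornerMn) /=.
  by field; rewrite !gt_eqF //; lra.
have cg (x : R) : 0 < x -> {for x, continuous g}.
  move=> x_gt0; rewrite /g; apply: cvgM.
    have [d _] := is_derive1_powR (alpha - 1) x_gt0.
    have H : {for x, continuous (@powR R ^~ (alpha - 1))}.
      exact/differentiable_continuous/derivable1_diffP.
    exact: H.
  have H : {for x, continuous (fun x : R => (1 - x / 2) ^+ 2)}.
    rewrite (_ : (fun _ => _) = horner ((1 - 2^-1 *: 'X) ^+ 2)).
      exact: continuous_horner.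
    by apply/funext => y; rewrite !hornerE mulrC.
  exact: H.
pose I := (\int[mu]_(x in `]0%R, +oo[) (x `^ (alpha - 1) * expR (- x))%:E)%E.
have I_ge0 : (0 <= I)%E.
  by apply: integral_ge0 => x _; rewrite lee_fin mulr_ge0 ?powR_ge0 ?expR_ge0.
have GammaE : Gamma alpha = fine I by [].
have I_fin : I \is a fin_num.
  by move: Gamma_gt0 I_ge0; rewrite GammaE; case: (I) => //=; rewrite ltxx.
have mI : measurable_fun [set: R] (fun x : R => (x `^ (alpha - 1) * expR (- x))%:E).
  apply/measurable_EFinP; apply: measurable_funM; first exact: measurable_powR.
  by apply: measurableT_comp => //; exact: oppr_measurable.
have lower (e : R) : 0 < e < 1 -> F 2 - F e <= Gamma alpha.
  move=> /andP[e0 e1].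
  have gE : (\int[mu]_(x in `[e, 2%R]) (g x)%:E = (F 2 - F e)%:E)%E.
    apply: integral_is_derive; first by lra.
      by move=> x /andP[ex _]; apply: dF; exact: lt_le_trans ex.
    by move=> x /andP[ex _]; apply: cg; exact: lt_le_trans ex.
  rewrite -lee_fin GammaE fineK // -gE.
  apply: (@le_trans _ _ (\int[mu]_(x in `[e, 2%R]) (x `^ (alpha - 1) * expR (- x))%:E)%E).
    apply: ge0_le_integral => //.
    + by move=> x _; rewrite lee_fin mulr_ge0 ?powR_ge0 ?sqr_ge0.
    + apply/measurable_EFinP; apply: subspace_continuous_measurable_fun => //.
      apply: continuous_in_subspaceT => x; rewrite inE /= in_itv /= => /andP[ex _].
      by apply: cg; exact: lt_le_trans ex.
    + exact: measurable_funS mI.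
    + move=> x; rewrite /= in_itv /= => /andP[ex x2].
      rewrite lee_fin ler_wpM2l ?powR_ge0 // sqr_onem_half_le_expRN // x2 andbT.
      exact: le_trans (ltW e0) ex.
  apply: ge0_subset_integral => //.
  - exact: measurable_funS mI.
  - by move=> x _; rewrite lee_fin mulr_ge0 ?powR_ge0 ?expR_ge0.
  - by move=> x /=; rewrite !in_itv /= andbT => /andP[ex _]; exact: lt_le_trans ex.
have F2 : F 2 = 2 * 2 `^ alpha / (alpha * (alpha + 1) * (alpha + 2)).
  by rewrite /F qE; field; rewrite !gt_eqF //; lra.
rewrite -F2; apply/ler_addgt0Pr => e e_gt0.
pose c := alpha^-1 + 1.
have c_gt0 : 0 < c by rewrite addr_gt0 ?invr_gt0.
have ec_gt0 : 0 < e / c by rewrite divr_gt0.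
pose m := Num.min (e / c) 2^-1; pose d := m `^ alpha^-1.
have m_gt0 : 0 < m by rewrite lt_min ec_gt0 invr_gt0 ltr0n.
have d_in : 0 < d < 1.
  have m_lt1 : m < 1 by rewrite gt_min; apply/orP; right; lra.
  have := @gt0_ltr_powR R alpha^-1; rewrite invr_gt0 => /(_ alpha_gt0 m 1).
  by rewrite !nnegrE (ltW m_gt0) ler01 m_lt1 powR1 /d powR_gt0 // => ->.
have dE : d `^ alpha = m by rewrite /d -powRrM mulVf ?gt_eqF // powRr1 ?ltW.
have := lower d d_in.
suff : F d <= e by lra.
rewrite /F dE.
have [d0 d1] := andP d_in.
have q_le : q.[d] <= c.
  rewrite qE /c.
  have h1 : 0 <= (alpha + 1)^-1 * d by rewrite mulr_ge0 ?invr_ge0 ?ltW //; lra.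
  have h2 : (4 * (alpha + 2))^-1 * d ^+ 2 <= 1.
    rewrite ler_pdivrMl ?mulr1; last by rewrite mulr_gt0 //; lra.
    by nra.
  by move: h1 h2; set u := _^-1 * d; set v := _^-1 * _; set z := alpha^-1; lra.
apply: le_trans (ler_wpM2l (ltW m_gt0) q_le) _.
by rewrite -ler_pdivlMr // /m ge_min lexx.
Qed.

End GammaLowerBound.

(** * Numerical bounds *)

Section NumericalBounds.
Variable R : realType.

Lemma le_of_is_derive_ge0 (f df : R -> R) (a b : R) : a <= b ->
  (forall x, a <= x <= b -> is_derive x 1 f (df x)) ->
  (forall x, a <= x <= b -> 0 <= df x) -> f a <= f b.
Proof.
move=> ab dfP df_ge0.
have dfP' x : x \in `]a, b[ -> is_derive x 1 f (df x).
  by rewrite in_itv /= => /andP[/ltW ax /ltW xb]; apply: dfP; rewrite ax.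
have cf : {within `[a, b], continuous f}.
  apply: derivable_within_continuous => x; rewrite in_itv /= => x_in.
  by have [] := dfP x x_in.
have [c c_in E] := MVT_segment ab dfP' cf.
by rewrite -subr_ge0 E mulr_ge0 ?subr_ge0 // df_ge0 //; move: c_in; rewrite in_itv.
Qed.

Lemma expR_ge_deg2 (x : R) : 0 <= x -> 1 + x + x ^+ 2 / 2 <= expR x.
Proof.
move=> x0; pose p : {poly R} := 1 + 'X + 2^-1 *: 'X^2.
have pE y : p.[y] = 1 + y + y ^+ 2 / 2.
  by rewrite /p !(hornerD, hornerC, hornerZ, hornerXn, hornerX) mulrC.
have := @le_of_is_derive_ge0 (fun y => expR y - p.[y]) (fun y => expR y - p^`().[y]) 0 x x0.
rewrite !pE expR0 expr0n /= mul0r !addr0 subrr subr_ge0; apply => y y_in.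
rewrite /p !(derivD, derivC, derivZ, derivX, derivXn).
rewrite !(hornerD, hornerC, hornerZ, hornerXn, hornerX, hornerMn) /=.
by have := expR_ge1Dx y; lra.
Qed.

Lemma expR_eighth_ge : 145 / 128 <= expR (8^-1) :> R.
Proof. by apply: le_trans (expR_ge_deg2 _); lra. Qed.

Lemma expR1_ge : 27 / 10 <= expR 1 :> R.
Proof.
have -> : expR 1 = expR 8^-1 ^+ 8 :> R by rewrite -expRM_natl; congr expR; lra.
apply: le_trans (_ : (145 / 128) ^+ 8 <= _); first by lra.
by rewrite ler_pXn2r ?nnegrE ?expR_ge0 ?expR_eighth_ge //; lra.
Qed.

Lemma expR_seven_eighths_ge : 23 / 10 <= expR (7 / 8) :> R.
Proof.
have -> : expR (7 / 8) = expR 8^-1 ^+ 7 :> R by rewrite -expRM_natl; congr expR; lra.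
apply: le_trans (_ : (145 / 128) ^+ 7 <= _); first by lra.
by rewrite ler_pXn2r ?nnegrE ?expR_ge0 ?expR_eighth_ge //; lra.
Qed.

Lemma ln2_ge : 2 / 3 <= ln 2 :> R.
Proof.
rewrite -ler_expR lnK ?posrE //.
have h : 1 / 2 <= expR (- (2 / 3)) :> R.
  have -> : expR (- (2 / 3)) = expR (- 24^-1) ^+ 16 :> R.
    by rewrite -expRM_natl; congr expR; lra.
  apply: le_trans (_ : (23 / 24) ^+ 16 <= _); first by lra.
  rewrite ler_pXn2r ?nnegrE ?expR_ge0 //.
  by apply: le_trans (expR_ge1Dx _); lra.
have := expRxMexpNx_1 (2 / 3 : R); have := expR_gt0 (2 / 3 : R).
by move: h; set a := expR (2 / 3); set b := expR _; nra.
Qed.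

(** [atan 1 <= 1 - 1 / 3 + 1 / 5], by truncating the alternating series. *)
Lemma pi_le : pi <= 7 / 2 :> R.
Proof.
pose p : {poly R} := 'X - 3^-1 *: 'X^3 + 5^-1 *: 'X^5.
have := @le_of_is_derive_ge0 (fun y => p.[y] - atan y)
  (fun y => p^`().[y] - (1 + y ^+ 2)^-1) 0 1 ler01.
have atan0 : atan 0 = 0 :> R.
  by rewrite -[in LHS]tan0 tanK // in_itv /= oppr_lt0 divr_gt0 ?pi_gt0.
rewrite atan0 atan1 /p !(hornerD, hornerN, hornerC, hornerZ, hornerXn, hornerX).
rewrite !expr0n !expr1n /= => h.
suff : 0 <= 1 - 3^-1 + 5^-1 - pi / 4 :> R by lra.
move: h; rewrite !mulr0 !mulr1 subr0 addr0 subr0; apply => y /andP[y0 y1].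
rewrite /p !(derivD, derivN, derivC, derivZ, derivX, derivXn).
rewrite !(hornerD, hornerN, hornerC, hornerZ, hornerXn, hornerX, hornerMn) /=.
have y2 : 0 < 1 + y ^+ 2 by rewrite ltr_pwDl ?sqr_ge0.
rewrite subr_ge0 -[leLHS]mul1r ler_pdivrMr //.
have : 0 <= y ^+ 6 by rewrite exprn_even_ge0.
by lra.
Qed.

(** The right-hand side is [2 x / (2 + x) * (1 + x ^ 2 / (8 (1 + x)))] in partial
    fractions; the difference has the derivative
    [x ^ 2 ((x + 1) ^ 2 + 1) / (4 (x + 1) ^ 2 (x + 2) ^ 2)]. *)
Lemma ln1p_le (x : R) : 0 <= x ->
  ln (1 + x) <= (x + 5 - (x + 1)^-1 - 8 * (x + 2)^-1) / 4.
Proof.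
move=> x0.
pose g (y : R) := (y + 5 - (y + 1)^-1 - 8 * (y + 2)^-1) / 4 - ln (1 + y).
pose dg (y : R) := (1 + (y + 1) ^- 2 + 8 * (y + 2) ^- 2) / 4 - (1 + y)^-1.
have dgP y : 0 <= y <= x -> is_derive y 1 g (dg y).
  move=> /andP[y0 _].
  have dD (c : R) : is_derive y 1 (fun z => z + c) 1.
    by have := is_deriveD (is_derive_id y (1 : R)) (is_derive_cst c y (1 : R)); rewrite addr0.
  have dV (c : R) : 0 < c -> is_derive y 1 (fun z => (z + c)^-1) (- (y + c) ^- 2).
    move=> c0; have yc : y + c != 0 by rewrite gt_eqF //; lra.
    by have := @is_deriveV _ (fun z => z + c) y 1 _ yc (dD c); rewrite /GRing.scale /= mulr1.
  have y1 : 0 < 1 + y by lra.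
  have dl : is_derive y 1 (fun z => ln (1 + z)) (1 + y)^-1.
    have d1 : is_derive y 1 (fun z => 1 + z) 1.
      have := is_deriveD (is_derive_cst (1 : R) y (1 : R)) (is_derive_id y (1 : R)).
      by rewrite add0r.
    by have := is_derive1_comp (is_derive1_ln y1) d1; rewrite mulr1.
  have dZ := is_deriveZ 8 (dV 2 ltac:(lra)).
  have H := is_deriveB (is_deriveZ 4^-1 (is_deriveB (is_deriveB (dD 5) (dV 1 ltr01)) dZ)) dl.
  have -> : g = (4^-1 \*: (((fun z => z + 5) - (fun z => (z + 1)^-1))
      - (8 \*: (fun z => (z + 2)^-1)))
     - (fun z => ln (1 + z)) :> (R -> R)).
    by apply/funext => z; rewrite /g !fctE /GRing.scale /= mulrC.
  apply: (is_derive_eq H); rewrite /dg /GRing.scale /=.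
  by rewrite mulrC; congr (_ * _ - _); ring.
have := @le_of_is_derive_ge0 g dg 0 x x0 dgP.
have -> : g 0 = 0 by rewrite /g !add0r addr0 ln1; lra.
suff dg_ge0 y : 0 <= y <= x -> 0 <= dg y.
  by move=> /(_ dg_ge0); rewrite /g subr_ge0.
move=> /andP[y0 _]; have y1 : 0 < y + 1 by lra.
have y2 : 0 < y + 2 by lra.
have -> : dg y = y ^+ 2 * ((y + 1) ^+ 2 + 1) / (4 * (y + 1) ^+ 2 * (y + 2) ^+ 2).
  by rewrite /dg [1 + y]addrC; field; rewrite !gt_eqF.
by rewrite divr_ge0 // ?mulr_ge0 ?addr_ge0 ?sqr_ge0.
Qed.

(** Half a Stirling formula: [ln n! - (n + 1/2) ln n + n - 1 / (8 n)]
    increases with [n], by [ln1p_le] at [1 / n], from the value [7/8] at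
    [n = 1]. *)
Lemma ln_fact_ge (n : nat) :
  (n.+1%:R + 1 / 2) * ln n.+1%:R - n.+1%:R + 7 / 8 + 1 / (8 * n.+1%:R)
  <= ln (n.+1`!%:R : R).
Proof.
elim: n => [|n IH]; first by rewrite ln1; lra.
rewrite factS natrM lnM ?posrE // ?ltr0n ?fact_gt0 //.
set N : R := n.+1%:R; have -> : n.+2%:R = N + 1 :> R by rewrite natr1.
have N_gt0 : 0 < N by rewrite ltr0n.
have step : (N + 1 / 2) * (ln (N + 1) - ln N) <= 1 + 1 / (8 * N) - 1 / (8 * (N + 1)).
  have -> : ln (N + 1) - ln N = ln (1 + N^-1).
    rewrite -ln_div ?posrE //; last by lra.
    by congr ln; rewrite mulrDl divff ?gt_eqF // mul1r.
  have iN : 0 <= N^-1 by rewrite invr_ge0 ltW.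
  have Nh : 0 <= N + 1 / 2 by lra.
  apply: le_trans (ler_wpM2l Nh (ln1p_le iN)) _.
  rewrite le_eqVlt; apply/orP; left; apply/eqP.
  by field; rewrite !gt_eqF //; lra.
move: IH step; rewrite -/N; set u := 1 / (8 * N); set v := 1 / (8 * (N + 1)).
set L := ln N; set L1 := ln (N + 1); set F := ln _.
lra.
Qed.

Lemma fact_ge_Stirling (n : nat) :
  23 / 10 * expR ((n.+1%:R + 1 / 2) * ln n.+1%:R - n.+1%:R) <= n.+1`!%:R :> R.
Proof.
have F_gt0 : (0 : R) < n.+1`!%:R by rewrite ltr0n fact_gt0.
rewrite -[leRHS](lnK (_ : _ \in Num.pos)) ?posrE //.
apply: le_trans (ler_wpM2r (expR_ge0 _) expR_seven_eighths_ge) _.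
rewrite -expRD ler_expR; apply: le_trans (ln_fact_ge n).
have : (0 : R) < 1 / (8 * n.+1%:R) by rewrite divr_gt0 // mulr_gt0.
by set u := 1 / _; lra.
Qed.

End NumericalBounds.

(** * The constant in the error bound *)

Section Vartheta.
Variable R : realType.

Definition vartheta_alpha (alpha : R) : R :=
  expR alpha * alpha `^ (- (1 / 2) - alpha)
  * (alpha * sinh (1 / alpha)) `^ (- (alpha / 2)).

Definition vartheta_lam (lam : R) : R :=
  1 / (4 * pi) * expR 1 * (1 + 2 * lam) `^ (- (1 / 2) - 2 * lam)
  * (1 + 1 / (1620 * (1 + lam) ^+ 5))
  * ((1 + lam) * csch (1 / (1 + 2 * lam)) / (1 + 2 * lam)) `^ (1 / 2 + lam)
  * ((1 + lam) * sinh (1 / (1 + lam))) `^ ((1 + lam) / 2).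

Lemma varthetaE (alpha lam : R) :
  vartheta alpha lam = vartheta_lam lam * vartheta_alpha alpha.
Proof. by rewrite /vartheta /vartheta_lam /vartheta_alpha expRD; ring. Qed.

Lemma sinh_gt0 (x : R) : 0 < x -> 0 < sinh x.
Proof. by move=> x0; rewrite /sinh divr_gt0 // subr_gt0 ltr_expR; lra. Qed.

Lemma sinh_le_half_expR (x : R) : sinh x <= expR x / 2.
Proof. by rewrite /sinh ler_pM2r ?invr_gt0 // lerBlDr lerDl expR_ge0. Qed.

Lemma vartheta_lam_gt0 (lam : R) : - (1 / 2) < lam -> 0 < vartheta_lam lam.
Proof.
move=> hlam; have l1 : 0 < 1 + lam by lra.
have l2 : 0 < 1 + 2 * lam by lra.
have s1 : 0 < sinh (1 / (1 + lam)) by apply: sinh_gt0; rewrite divr_gt0.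
have s2 : 0 < csch (1 / (1 + 2 * lam)).
  by rewrite invr_gt0; apply: sinh_gt0; rewrite divr_gt0.
rewrite /vartheta_lam; have : (0 : R) < 1620 by rewrite ltr0n.
(* only the sign of this number matters *)
move: 1620 => k k0.
have c0 : 0 < 1 + 1 / (k * (1 + lam) ^+ 5).
  by rewrite addr_gt0 // divr_gt0 // mulr_gt0 // exprn_gt0.
have p0 : 0 < 1 / (4 * pi) :> R by rewrite divr_gt0 // mulr_gt0 ?pi_gt0.
have q1 : 0 < (1 + lam) * csch (1 / (1 + 2 * lam)) / (1 + 2 * lam).
  by rewrite divr_gt0 // mulr_gt0.
have q2 : 0 < (1 + lam) * sinh (1 / (1 + lam)) by rewrite mulr_gt0.
apply: mulr_gt0; last exact: powR_gt0.
apply: mulr_gt0; last exact: powR_gt0.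
apply: mulr_gt0; last exact: c0.
apply: mulr_gt0; last exact: powR_gt0.
by apply: mulr_gt0 => //; exact: expR_gt0.
Qed.

Lemma vartheta_alpha_gt0 (alpha : R) : 0 < alpha -> 0 < vartheta_alpha alpha.
Proof.
move=> a0; rewrite /vartheta_alpha !mulr_gt0 ?expR_gt0 ?powR_gt0 //.
by rewrite mulr_gt0 // sinh_gt0 // divr_gt0.
Qed.

(** For [lam = 0] the last two powers cancel, and [vartheta] exceeds the sharp
    constant by a factor close to [e]; this leaves room for crude bounds. *)
Lemma vartheta_lam0_ge : 27 / 140 <= vartheta_lam 0.
Proof.
rewrite /vartheta_lam; have : (0 : R) < 1620 by rewrite ltr0n.
move: 1620 => k k0; rewrite !mulr0 !addr0 !expr1n !mulr1 powR1.
have sinh1 : 0 < sinh (1 : R) by apply: sinh_gt0.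
rewrite !mul1r !invr1 !mulr1 -[X in _ <= X]mulrA -powRM ?invr_ge0 ?(ltW sinh1) //.
rewrite mulVf ?gt_eqF // powR1 !mulr1.
have p0 := pi_gt0 R.
have p1 : 14^-1 <= (4 * pi)^-1 :> R.
  by rewrite lef_pV2 ?posrE ?mulr_gt0 //; have := pi_le R; lra.
have h : 14^-1 * (27 / 10) <= (4 * pi)^-1 * expR 1 :> R.
  by apply: ler_pM => //; exact: expR1_ge.
apply: le_trans (_ : 14^-1 * (27 / 10) <= _); first by lra.
apply: le_trans h _; rewrite -[leLHS]mulr1 ler_wpM2l //.
  by rewrite mulr_ge0 ?expR_ge0 // invr_ge0 mulr_ge0 // ltW.
by rewrite lerDl invr_ge0 ltW.
Qed.

(** By [Gamma_ge] and [sinh (1 / alpha) <= exp (1 / alpha) / 2] the product is at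
    least [2 ^ (3 (1 + alpha) / 2) / ((alpha + 1) (alpha + 2))], once
    [alpha ^ (- 3 alpha / 2) >= 1] is dropped and the remaining
    [exp (alpha - 1 / 2) / sqrt alpha] is bounded below by [sqrt 2], by
    [ln (2 alpha) <= 2 alpha - 1]. *)
Lemma vartheta_alpha_Gamma_ge (alpha : R) : 0 < alpha < 1 -> 0 < Gamma alpha ->
  113 / 100 <= vartheta_alpha alpha * (alpha * Gamma alpha).
Proof.
move=> /andP[a0 a1] G0.
have G_ge := Gamma_ge a0 G0.
have two0 : (0 : R) < 2 by lra.
set l2 : R := ln 2; set la := ln alpha.
have la_le0 : la <= 0 by rewrite ln_le0 // ltW.
have la_le : l2 + la <= 2 * alpha - 1.
  rewrite -lnM ?posrE // -[2 * alpha in leLHS](subrKC 1).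
  by apply: le_ln1Dx; lra.
have inv_a : 0 < 1 / alpha by rewrite divr_gt0.
have s0 : 0 < alpha * sinh (1 / alpha) by rewrite mulr_gt0 // sinh_gt0.
have s_le : alpha * sinh (1 / alpha) <= expR (la + 1 / alpha - l2).
  rewrite expRD expRN !expRD !lnK ?posrE // -mulrA ler_pM2l //.
  exact: sinh_le_half_expR.
have W_ge : expR (alpha + (- (1 / 2) - alpha) * la - alpha / 2 * (la + 1 / alpha - l2))
    <= vartheta_alpha alpha.
  rewrite expRD (expRD alpha) /vartheta_alpha (powR_expR_ln _ a0).
  rewrite ler_pM2l ?mulr_gt0 ?expR_gt0 // powRN expRN.
  rewrite lef_pV2 ?posrE ?expR_gt0 ?powR_gt0 //.
  rewrite [alpha / 2 * (_ - _)]mulrC expRM.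
  apply: ge0_ler_powR; rewrite ?nnegrE ?expR_ge0 ?(ltW s0) //.
  by rewrite divr_ge0 // ltW.
have aG_ge : 2 * expR (alpha * l2) / ((alpha + 1) * (alpha + 2)) <= alpha * Gamma alpha.
  rewrite -(ler_pM2l a0) in G_ge; apply: le_trans G_ge.
  rewrite (powR_expR_ln _ two0) le_eqVlt; apply/orP; left; apply/eqP.
  by field; rewrite !gt_eqF //; lra.
have d0 : 0 < (alpha + 1) * (alpha + 2) by rewrite mulr_gt0; lra.
have L_ge0 : 0 <= 2 * expR (alpha * l2) / ((alpha + 1) * (alpha + 2)).
  by apply: divr_ge0; [rewrite mulr_ge0 ?expR_ge0|exact: ltW].
apply: le_trans (ler_pM (expR_ge0 _) L_ge0 W_ge aG_ge).
rewrite mulrA ler_pdivlMr // [leRHS]mulrCA -expRD.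
have exp_le : l2 / 2 + 3 / 2 * alpha * l2 <=
    alpha + (- (1 / 2) - alpha) * la - alpha / 2 * (la + 1 / alpha - l2) + alpha * l2.
  have -> : alpha / 2 * (la + 1 / alpha - l2) = alpha * la / 2 + 1 / 2 - alpha * l2 / 2.
    by field; rewrite gt_eqF.
  have : 0 <= - (alpha * la) by rewrite oppr_ge0 mulr_ge0_le0 // ltW.
  by lra.
have := exp_le; rewrite -ler_expR => {}exp_le.
have E1 : expR (l2 / 2) ^+ 2 = 2 by rewrite -expRM_natl mulrC divfK // lnK.
have E2 : 7 / 5 <= expR (l2 / 2).
  have : (7 / 5) ^+ 2 <= expR (l2 / 2) ^+ 2 by rewrite E1; lra.
  by rewrite ler_pXn2r // nnegrE ?expR_ge0 //; lra.
have E3 : 1 + alpha + alpha ^+ 2 / 2 <= expR (3 / 2 * alpha * l2).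
  apply: le_trans (expR_ge_deg2 (ltW a0)) _; rewrite ler_expR.
  have h := ln2_ge R; rewrite -/l2 in h.
  by have := ler_wpM2l (ltW a0) h; lra.
apply: le_trans (ler_wpM2l (ltW two0) exp_le).
rewrite expRD; have E4 := ler_pM (_ : 0 <= 7 / 5 :> R)
  (_ : 0 <= 1 + alpha + alpha ^+ 2 / 2) E2 E3.
apply: le_trans (_ : 2 * (7 / 5 * (1 + alpha + alpha ^+ 2 / 2)) <= _).
  by nra.
rewrite ler_pM2l //; apply: E4; first by lra.
by nra.
Qed.

End Vartheta.

(** * Shifted polynomials and the truncation error *)

Section ShiftedGegenbauer.
Variables (R : realType) (lam : R).
Hypothesis hlam : - (1 / 2) < lam.
Local Notation SG := (shifted_gegenbauer lam).

Lemma horner_shifted_gegenbauer (n : nat) (x : R) :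
  (SG n).[x] = (gegenbauer lam n).[2 * x - 1].
Proof. by rewrite horner_comp hornerD hornerN hornerZ hornerX hornerC. Qed.

Lemma shifted_gegenbauer_factor (n : nat) : exists s : seq R,
  [/\ size s = n.+1, uniq s, {in s, forall y, 0 < y < 1} &
      forall x, (SG n.+1).[x]
        = 2 * 4 ^+ n * lead_ratio lam n * \prod_(z <- s) (x - z)].
Proof.
have [s [s_in s_incr GE]] := gegenbauer_roots n.+1 hlam.
pose y i := (1 + s i) / 2.
have y_lt i j : (i < j)%N -> (j < n.+1)%N -> y i < y j.
  by move=> ij jn; have := s_incr i j; rewrite ij jn => /(_ isT); rewrite /y; lra.
exists (map y (iota 0 n.+1)); split.
- by rewrite size_map size_iota.
- rewrite map_inj_in_uniq ?iota_uniq // => i j; rewrite !mem_iota !add0n => im jm yij.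
  by case: (ltngtP i j) => // ij; have := y_lt _ _ ij; rewrite yij ltxx;
    [move/(_ jm)|move/(_ im)].
- move=> z /mapP[i]; rewrite mem_iota add0n => /s_in /andP[s1 s2] ->.
  by rewrite /y; apply/andP; split; lra.
move=> x; rewrite horner_shifted_gegenbauer GE (lead_coef_gegenbauer hlam n).2.
rewrite hornerZ horner_prod big_map.
have -> : iota 0 n.+1 = index_iota 0 n.+1 by rewrite /index_iota subn0.
rewrite big_mkord.
have -> : \prod_(i < n.+1) ('X - (s i)%:P).[2 * x - 1] = \prod_(i < n.+1) (2 * (x - y i)).
  by apply: eq_bigr => i _; rewrite hornerXsubC /y; field.
rewrite big_split /= prodr_const card_ord.
have -> : 4 ^+ n = 2 ^+ n * 2 ^+ n :> R by rewrite -exprMn; congr (_ ^+ _); ring.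
by rewrite exprS; ring.
Qed.

Lemma SGG_interpolantP (n : nat) (f : R -> R) :
  (size (SGG_interpolant lam n f) <= n.+1)%N /\
  (forall x, SGG_points lam n x -> (SGG_interpolant lam n f).[x] = f x).
Proof.
rewrite /SGG_interpolant; set A := [set p : {poly R} | _].
suff [p Ap] : exists p, A p by exact: (xgetPex 0 (ex_intro _ p Ap)).
have [s [size_s s_uniq s_in GE]] := shifted_gegenbauer_factor n.
have [p size_p ps] := interpolant_exists f s_uniq.
exists p; split; first by rewrite -size_s.
move=> x [x_in /rootP]; rewrite GE => /eqP; rewrite mulf_eq0.
rewrite gt_eqF ?mulr_gt0 ?exprn_gt0 ?lead_ratio_gt0 //= => w0; apply: ps.
by rewrite -root_prod_XsubC rootE horner_prod; under eq_bigr do rewrite hornerXsubC.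
Qed.

Lemma interpolation_error_le (n : nat) (f : R -> R) (x : R) :
  (forall m, C01 m.+1 f) -> 0 < x < 1 ->
  `|f x - (SGG_interpolant lam n f).[x]|
  <= deriv_norm n.+1 f / (n.+1`!%:R * (2 * 4 ^+ n)) / lead_ratio lam n
     * `|(SG n.+1).[x]|.
Proof.
move=> fC x_in.
have [size_p ps] := SGG_interpolantP n f.
have [s [size_s s_uniq s_in GE]] := shifted_gegenbauer_factor n.
have P0 := lead_ratio_gt0 hlam n.
have four0 : (0 : R) < 2 * 4 ^+ n by rewrite mulr_gt0 ?exprn_gt0.
have fact0 : (0 : R) < n.+1`!%:R by rewrite ltr0n fact_gt0.
have [||y y_in ->] :=
  @interpolation_remainder R 0 1 f n s _ x _ size_s s_uniq s_in size_p _ x_in.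
- by move=> k y kn y_in; have [_ df _] := fC n; exact: df.
- move=> y ys; apply: ps; split; first exact: s_in.
  rewrite rootE GE (_ : \prod_(z <- s) _ = 0) ?mulr0 //.
  by apply/eqP; rewrite prodf_seq_eq0; apply/hasP; exists y; rewrite ?subrr ?eqxx.
have h := normr_derive1n_le (fC n.+1) y_in.
have -> : \prod_(z <- s) (x - z) = (SG n.+1).[x] / (2 * 4 ^+ n * lead_ratio lam n).
  by rewrite GE mulrC mulKf // gt_eqF // mulr_gt0.
rewrite !normrM !normfV !normrM (gtr0_norm P0) (gtr0_norm fact0) -(normrM 2) (gtr0_norm four0).
set N := `|derive1n _ _ _|; set g := `|_.[x]|.
have -> : N / n.+1`!%:R * (g / (2 * 4 ^+ n * lead_ratio lam n))
   = N * (g / (n.+1`!%:R * (2 * 4 ^+ n) * lead_ratio lam n)).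
  by rewrite !invfM; ring.
have -> : deriv_norm n.+1 f / (n.+1`!%:R * (2 * 4 ^+ n)) / lead_ratio lam n * g
   = deriv_norm n.+1 f * (g / (n.+1`!%:R * (2 * 4 ^+ n) * lead_ratio lam n)).
  by rewrite !invfM; ring.
rewrite ler_wpM2r // divr_ge0 ?normr_ge0 //.
by rewrite mulr_ge0 ?mulr_ge0 // ltW.
Qed.

Lemma truncation_error_le (alpha t : R) (n : nat) (f : R -> R) :
  0 < alpha -> 0 <= t <= 1 -> (forall m, C01 m.+1 f) ->
  `|truncation_error alpha lam n f t|
  <= (Gamma alpha)^-1 * (deriv_norm n.+1 f / (n.+1`!%:R * (2 * 4 ^+ n))
        / lead_ratio lam n * kernel_integral alpha t (SG n.+1)).
Proof.
move=> alpha_gt0 t_in fC; apply: RL_integral_sub_le => //.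
  by have [] := fC 0%N.
by move=> x x_in; exact: interpolation_error_le.
Qed.

Lemma shifted_gegenbauer_le1 (n : nat) (x : R) : 0 <= lam -> 0 <= x <= 1 ->
  `|(SG n).[x]| <= 1.
Proof.
move=> l0 /andP[x0 x1]; rewrite horner_shifted_gegenbauer.
by apply: gegenbauer_le1 => //; apply/andP; split; lra.
Qed.

Lemma shifted_gegenbauer_cvg0 (x : R) : 0 < lam -> 0 < x < 1 ->
  (SG n.+1).[x] @[n --> \oo] --> (0 : R).
Proof.
move=> l0 /andP[x0 x1]; pose y := 2 * x - 1.
have y_in : -1 < y < 1 by apply/andP; rewrite /y; split; lra.
have [y1 y2] := andP y_in.
pose c := lam * (1 - y ^+ 2).
have c0 : 0 < c by rewrite mulr_gt0 //; nra.
apply/cvgrPdist_lt => e e0.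
pose K := 6 * (1 + lam) / (c * e ^+ 2) + 1.
exists (Num.truncn (expR K)).+1 => // n /= n_ge.
rewrite sub0r normrN horner_shifted_gegenbauer -/y.
have H_gt : 6 * (1 + lam) / (c * e ^+ 2) < harmonic_sum R n.
  apply: lt_le_trans (ln_le_harmonic_sum R n).
  apply: (@lt_le_trans _ _ K); first by rewrite /K ltrDl.
  rewrite -ler_expR lnK ?posrE //; apply: ltW.
  apply: lt_le_trans (truncnS_gt _) _; rewrite ler_nat; exact: leqW.
have D := gegenbauer_decay hlam n l0 y_in; rewrite -/c in D.
rewrite ltNge; apply/negP => e_le.
have e2 : e ^+ 2 <= (gegenbauer lam n.+1).[y] ^+ 2.
  by rewrite -[leRHS]real_normK ?num_real // ler_pXn2r ?nnegrE // ltW.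
have ce0 : 0 < c * e ^+ 2 := mulr_gt0 c0 (exprn_gt0 2 e0).
move: H_gt; rewrite ltr_pdivrMr // => H_gt.
have h0 : 0 <= c * harmonic_sum R n by apply: mulr_ge0 (ltW c0) _; exact: sumr_ge0.
have := ler_wpM2l h0 e2; lra.
Qed.

Lemma shifted_gegenbauer_le_powR (n : nat) (x : R) : lam < 0 -> 0 <= x <= 1 ->
  `|(SG n.+4).[x]| <= 3 / (1 + 2 * lam) * n.+3%:R `^ (- lam).
Proof.
move=> l0 /andP[x0 x1]; rewrite horner_shifted_gegenbauer.
by apply: gegenbauer_le_powR => //; apply/andP; split; lra.
Qed.

End ShiftedGegenbauer.

Section Assembly.
Variables (R : realType) (lam : R).
Hypothesis hlam : - (1 / 2) < lam.
Local Notation SG := (shifted_gegenbauer lam).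

(** [23 / 10 * 2 = 46 / 10], where [23 / 10] is the constant of
    [fact_ge_Stirling] and the factor [2] comes from the leading coefficient. *)
Lemma fact_inv_le (m : nat) :
  (m.+2`!%:R * (2 * 4 ^+ m.+1))^-1
  <= 10 / 46 * ((expR 1 / 4) ^+ m.+1 * m.+1%:R `^ (- (3 / 2) - m.+1%:R)) :> R.
Proof.
have F := fact_ge_Stirling R m.
have n0 : (0 : R) < m.+1%:R by rewrite ltr0n.
set n : R := m.+1%:R; set q := (_ `^ _).
have q0 : 0 < q by rewrite powR_gt0.
have four0 : (0 : R) < 4 ^+ m.+1 by rewrite exprn_gt0.
have e0 : (0 : R) < expR 1 ^+ m.+1 by rewrite exprn_gt0 ?expR_gt0.
have key : 23 / 10 <= m.+2`!%:R * (expR 1 ^+ m.+1 * q).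
  have eE : n * expR ((n + 1 / 2) * ln n - n) * (expR 1 ^+ m.+1 * q) = 1.
    rewrite -expRM_natr mul1r /q (powR_expR_ln _ n0).
    rewrite -[X in X * expR _](lnK (_ : _ \in Num.pos)) ?posrE //.
    rewrite -!expRD -[RHS]expR0; congr expR; rewrite -/n; lra.
  have -> : 23 / 10 = n * (23 / 10 * expR ((n + 1 / 2) * ln n - n)) * (expR 1 ^+ m.+1 * q).
    rewrite -[LHS]mulr1 -[X in _ * X = _]eE; ring.
  rewrite ler_wpM2r ?(mulr_ge0 (ltW e0) (ltW q0)) // factS natrM.
  apply: ler_pM => //; by rewrite ler_nat.
rewrite -[leLHS]mul1r ler_pdivrMr; last by rewrite mulr_gt0 ?mulr_gt0 // ltr0n fact_gt0.
rewrite expr_div_n; move: key; set F2 : R := m.+2`!%:R; set E := expR 1 ^+ _.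
set f := 4 ^+ _ => key.
have -> : 10 / 46 * (E / f * q) * (F2 * (2 * f)) = 10 / 23 * (F2 * (E * q)).
  by field; rewrite gt_eqF.
by lra.
Qed.

(** Isolates what does not depend on [f]. *)
Lemma asymp_le_of_scalar (alpha sigma : R) (f : R -> R) :
  0 < alpha < 1 -> 0 < sigma -> (forall n : nat, C01 n.+1 f) ->
  (0 < Gamma alpha -> \forall n \near \oo, forall t, 0 <= t <= 1 ->
     10 / 46 * kernel_integral alpha t (SG n.+1)
     <= Gamma alpha * lead_ratio lam n
        * (vartheta alpha lam * n%:R `^ lam * Upsilon lam sigma n)) ->
  asymp_le_on `[0, 1]
    (fun n t => `|truncation_error alpha lam n f t|)
    (fun n => deriv_norm n.+1 f * vartheta alpha lam * (expR 1 / 4) ^+ n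
              * n%:R `^ (- (3 / 2) - n%:R + lam) * Upsilon lam sigma n).
Proof.
move=> /andP[a0 a1] sigma_gt0 fC scalar.
exists (fun=> 0); split; first exact: cvg_cst.
have A_ge0 n : 0 <= deriv_norm n f by exact: fine_ge0 (Lnorm_ge0 _ _ _).
have th_gt0 : 0 < vartheta alpha lam.
  by rewrite varthetaE mulr_gt0 ?vartheta_lam_gt0 ?vartheta_alpha_gt0.
have Y_ge0 n : 0 <= Upsilon lam sigma n.
  by rewrite /Upsilon; case: ifP => // _; rewrite mulr_ge0 ?powR_ge0 // ltW.
have e4 : 0 <= expR 1 / 4 :> R by rewrite divr_ge0 ?expR_ge0.
have [G0|G0] := leP (Gamma alpha) 0.
  have {}G0 : Gamma alpha = 0 by apply/eqP; rewrite eq_le G0 Gamma_ge0.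
  apply: nearW => n t; rewrite /= in_itv /= => t_in.
  apply: le_trans (truncation_error_le hlam n a0 t_in fC) _.
  rewrite G0 invr0 mul0r addr0 mul1r mulr_ge0 ?Y_ge0 // mulr_ge0 ?powR_ge0 //.
  by rewrite mulr_ge0 ?exprn_ge0 // mulr_ge0 // ltW.
have [N _ HN] := scalar G0.
exists N.+1 => // -[//|m] /= Nm t; rewrite in_itv /= => t_in.
have {HN} HN := HN m.+1 (ltnW Nm) t t_in.
apply: le_trans (truncation_error_le hlam m.+1 a0 t_in fC) _.
have P0 := lead_ratio_gt0 hlam m.+1.
have n0 : (0 : R) < m.+1%:R by rewrite ltr0n.
rewrite addr0 mul1r powRD; last by rewrite (gt_eqF n0) implybT.
have Finv := fact_inv_le m.
set Q := (_ ^+ _ * _) in Finv.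
have Q_ge0 : 0 <= Q by rewrite mulr_ge0 ?powR_ge0 ?exprn_ge0.
move: (A_ge0 m.+2) HN Finv; set A := deriv_norm _ f; set J := kernel_integral _ _ _.
set P := lead_ratio _ _ in P0 *; set G := Gamma _ in G0 *; set th := vartheta _ _.
set Y := Upsilon _ _ _; set L := _ `^ lam; set F := _ * (2 * _) => A0 HN Finv.
have J0 : 0 <= J.
  by apply: Rintegral_ge0 => x _; rewrite mulr_ge0 ?powR_ge0.
have GP : 0 < G * P by rewrite mulr_gt0.
have -> : A * th * (expR 1 / 4) ^+ m.+1 * (m.+1%:R `^ (- (3 / 2) - m.+1%:R) * L) * Y
  = A * (Q * (th * L * Y)) by rewrite /Q; ring.
have -> : G^-1 * (A / F / P * J) = A * (F^-1 * (J / (G * P))).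
  by rewrite [(G * P)^-1]invfM; ring.
rewrite ler_wpM2l //.
apply: (@le_trans _ _ (10 / 46 * Q * (J / (G * P)))).
  by rewrite ler_wpM2r // divr_ge0 // ltW.
have -> : 10 / 46 * Q * (J / (G * P)) = Q * (10 / 46 * J / (G * P)) by ring.
by rewrite ler_wpM2l // ler_pdivrMr // [leRHS]mulrC.
Qed.

(** For [lam > 0] the kernel integrals tend to [0]: the average of an
    oscillating polynomial is small, although its maximum is [1]. *)
Lemma scalar_bound_pos (alpha : R) : 0 < lam -> 0 < alpha < 1 -> 0 < Gamma alpha ->
  \forall n \near \oo, forall t, 0 <= t <= 1 ->
     10 / 46 * kernel_integral alpha t (SG n.+1)
     <= Gamma alpha * lead_ratio lam n * (vartheta alpha lam * n%:R `^ lam).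
Proof.
move=> l0 a_in G0; have [a0 a1] := andP a_in.
have th_gt0 : 0 < vartheta alpha lam.
  by rewrite varthetaE mulr_gt0 ?vartheta_lam_gt0 ?vartheta_alpha_gt0.
move: (vartheta alpha lam) th_gt0 => th th_gt0.
pose e := Gamma alpha * expR (- `|lam|) * th.
have e0 : 0 < e by rewrite /e mulr_gt0 // mulr_gt0 // expR_gt0.
have [N _ HN] := kernel_integral_small (w := fun n => SG n.+1) a_in e0
  (fun n x => @shifted_gegenbauer_le1 R lam hlam n.+1 x (ltW l0))
  (fun x => @shifted_gegenbauer_cvg0 R lam hlam x l0).
exists N.+1 => // -[//|m] /= Nm t t_in.
have J_le := HN m.+1 (ltnW Nm) t t_in.
have n0 : (0 : R) < m.+1%:R by rewrite ltr0n.
have nl : 0 < m.+1%:R `^ lam :> R by rewrite powR_gt0.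
have P_ge := lead_ratio_ge hlam m.
have J0 : 0 <= kernel_integral alpha t (SG m.+2).
  by apply: Rintegral_ge0 => x _; rewrite mulr_ge0 ?powR_ge0.
apply: (@le_trans _ _ e); first by lra.
have eE : e = Gamma alpha * (expR (- `|lam|) * m.+1%:R `^ (- lam))
    * (th * m.+1%:R `^ lam).
  by rewrite /e powRN; field; rewrite gt_eqF.
rewrite eE ler_wpM2r ?mulr_ge0 ?(ltW th_gt0) ?(ltW nl) //.
by rewrite ler_wpM2l // ltW.
Qed.

(** Here [113 / 100 * (27 / 140) >= 10 / 46]. *)
Lemma scalar_bound_0 (alpha t : R) (n : nat) :
  lam = 0 -> 0 < alpha < 1 -> 0 < Gamma alpha -> 0 <= t <= 1 ->
  10 / 46 * kernel_integral alpha t (SG n.+2)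
  <= Gamma alpha * lead_ratio lam n.+1 * vartheta alpha lam.
Proof.
move=> l0 a_in G0 /andP[t0 t1]; have [a0 a1] := andP a_in.
have P_ge1 : 1 <= lead_ratio lam n.+1.
  have := lead_ratio_ge hlam n.
  by rewrite l0 normr0 oppr0 expR0 powRr0 mulr1.
have J_le : kernel_integral alpha t (SG n.+2) <= 1 / alpha.
  apply: le_trans (_ : 1 * (t `^ alpha / alpha) <= _).
    apply: kernel_integral_le => // x /andP[x0 xt].
    apply: shifted_gegenbauer_le1 => //; first by rewrite l0.
    by rewrite x0 (le_trans xt).
  rewrite mul1r ler_pM2r ?invr_gt0 //.
  have := @ge0_ler_powR R alpha (ltW a0) t 1.
  by rewrite powR1 !nnegrE => ->.
have W := vartheta_alpha_Gamma_ge a_in G0.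
have B := vartheta_lam0_ge R.
have w0 := vartheta_alpha_gt0 a0.
rewrite varthetaE [vartheta_lam lam](_ : _ = vartheta_lam 0) ?l0 //.
move: (vartheta_alpha alpha) (vartheta_lam 0) W B w0 => w b W B w0.
rewrite l0 in P_ge1 J_le; move: J_le P_ge1 W; set J := kernel_integral _ _ _.
set P := lead_ratio _ _; set G := Gamma _ in G0 *; move=> J_le P_ge1 W.
have b0 : 0 < b by lra.
have c : 10 / 46 <= b * (w * (alpha * G)).
  have := ler_pM (_ : 0 <= 27 / 140 :> R) (_ : 0 <= 113 / 100 :> R) B W.
  by move=> h; apply: le_trans (h _ _); lra.
apply: (@le_trans _ _ (10 / 46 * (1 / alpha))).
  by rewrite ler_wpM2l //; lra.
rewrite mulrA mulr1 ler_pdivrMr //.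
apply: le_trans c _.
have -> : G * P * (b * w) * alpha = b * (w * (alpha * G)) * P by ring.
by rewrite ler_peMr // !mulr_ge0 // ltW.
Qed.

(** The growth [n ^ (- lam)] of the polynomials is that of [Upsilon]; what is left
    is a constant, bounded independently of [alpha]. *)
Lemma scalar_bound_neg (alpha t sigma : R) (n : nat) :
  lam < 0 -> 0 < alpha < 1 -> 0 < Gamma alpha -> 0 <= t <= 1 ->
  3 / (1 + 2 * lam) * expR `|lam| / vartheta_lam lam <= sigma ->
  10 / 46 * kernel_integral alpha t (SG n.+4)
  <= Gamma alpha * lead_ratio lam n.+3
     * (vartheta alpha lam * n.+3%:R `^ lam * (sigma * n.+3%:R `^ (- lam))).
Proof.
move=> l0 a_in G0 /andP[t0 t1] sigma_ge; have [a0 a1] := andP a_in.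
have l1 : 0 < 1 + 2 * lam by move: hlam; lra.
have n0 : (0 : R) < n.+3%:R by rewrite ltr0n.
have B0 := vartheta_lam_gt0 hlam.
have W0 := vartheta_alpha_gt0 a0.
have W := vartheta_alpha_Gamma_ge a_in G0.
have P_ge := lead_ratio_ge hlam n.+2.
have nl : 0 < n.+3%:R `^ lam :> R by rewrite powR_gt0.
have nnl : 0 < n.+3%:R `^ (- lam) :> R by rewrite powR_gt0.
have nE : n.+3%:R `^ lam * n.+3%:R `^ (- lam) = 1 :> R.
  by rewrite powRN divff // gt_eqF.
set S := 3 / (1 + 2 * lam) in sigma_ge *.
have S0 : 0 < S by rewrite divr_gt0.
have J_le : kernel_integral alpha t (SG n.+4) <= S * n.+3%:R `^ (- lam) / alpha.
  apply: le_trans (_ : S * n.+3%:R `^ (- lam) * (t `^ alpha / alpha) <= _).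
    apply: kernel_integral_le => // x /andP[x0 xt].
    by apply: shifted_gegenbauer_le_powR => //; rewrite x0 (le_trans xt).
  rewrite ler_wpM2l ?(ltW (mulr_gt0 S0 nnl)) // -[X in _ <= X]mul1r.
  rewrite ler_pM2r ?invr_gt0 //.
  have := @ge0_ler_powR R alpha (ltW a0) t 1.
  by rewrite powR1 !nnegrE => ->.
rewrite varthetaE.
move: (vartheta_alpha alpha) (vartheta_lam lam) W B0 W0 sigma_ge => w b.
move=> W b0 w0 sigma_ge; move: W J_le P_ge; set J := kernel_integral _ _ _.
set P := lead_ratio _ _; set G := Gamma _ in G0 *; set E := expR `|lam| in sigma_ge *.
move=> W J_le P_ge.
have E0 : 0 < E by exact: expR_gt0.
rewrite expRN -/E in P_ge.
have s0 : 0 < sigma by apply: lt_le_trans sigma_ge; exact: divr_gt0 (mulr_gt0 S0 E0) b0.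
move: J_le P_ge nE; set u := _ `^ lam; set v := _ `^ (- lam) => J_le P_ge nE.
have -> : G * P * (b * w * u * (sigma * v)) = G * P * (b * w * sigma) * (u * v) by ring.
rewrite nE mulr1.
apply: (@le_trans _ _ (10 / 46 * (S * v / alpha))).
  by rewrite ler_wpM2l //; lra.
apply: (@le_trans _ _ (G * (E^-1 * v) * (b * w * sigma))); last first.
  rewrite ler_wpM2r //; last by rewrite ler_wpM2l // ltW.
  by rewrite mulr_ge0 ?mulr_ge0 // ltW.
have h1 : S * E / b * (b * E^-1) <= sigma * (b * E^-1).
  by rewrite ler_wpM2r // mulr_ge0 ?invr_ge0 // ltW.
have h2 : S * E / b * (b * E^-1) = S by field; rewrite !gt_eqF.
rewrite h2 in h1.
have v0 : 0 < v by exact: nnl.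
rewrite mulrA ler_pdivrMr //.
have -> : G * (E^-1 * v) * (b * w * sigma) * alpha
  = v * ((sigma * (b * E^-1)) * (w * (alpha * G))) by ring.
have -> : 10 / 46 * (S * v) = v * (S * (10 / 46)) by ring.
rewrite ler_wpM2l ?(ltW v0) //; apply: ler_pM => //; first exact: ltW.
by lra.
Qed.

End Assembly.

Theorem theorem4p2 (R : realType) (lam : R) (hlam : - (1 / 2) < lam) :
  exists sigma : R, 1 < sigma /\
    forall (alpha : R) (f : R -> R),
      0 < alpha < 1 ->
      (forall n : nat, C01 n.+1 f) ->
      asymp_le_on `[0, 1]
        (fun n t => `|truncation_error alpha lam n f t|)
        (fun n => deriv_norm n.+1 f * vartheta alpha lam * (expR 1 / 4) ^+ n
                  * n%:R `^ (- (3 / 2) - n%:R + lam) * Upsilon lam sigma n).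
Proof.
have c0 : 0 <= 3 / (1 + 2 * lam) * expR `|lam| / vartheta_lam lam.
  rewrite divr_ge0 ?(ltW (vartheta_lam_gt0 hlam)) // mulr_ge0 ?expR_ge0 //.
  by rewrite divr_ge0 //; lra.
exists (2 + 3 / (1 + 2 * lam) * expR `|lam| / vartheta_lam lam).
set sigma := 2 + _; have sigma1 : 1 < sigma by rewrite /sigma; lra.
split => // alpha f a_in fC; apply: asymp_le_of_scalar => //; first by lra.
move=> G0; have [l0|l0|l0] := ltgtP lam 0.
- exists 3%N => // -[|[|[|n]]] // _ t t_in.
  rewrite /Upsilon ifF; last by apply/negbTE; rewrite -ltNge.
  apply: scalar_bound_neg => //.
  by rewrite /sigma lerDr; lra.
- have [N _ HN] := scalar_bound_pos hlam l0 a_in G0.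
  exists N => // n Nn t t_in; rewrite /Upsilon ifT ?(ltW l0) // mulr1.
  exact: HN.
- exists 1%N => // -[//|n] _ t t_in.
  rewrite /Upsilon ifT; last by rewrite l0.
  have -> : n.+1%:R `^ lam = 1 :> R by rewrite l0 powRr0.
  rewrite !mulr1; exact: scalar_bound_0.
Qed.
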